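(* Consider the half-duplex bi-directional multiple-relay channel under the two-phase $(m,2)$ DF MABC protocol described in the context, with fixed durations $\Delta_1,\Delta_2\ge 0$, $\Delta_1+\Delta_2=1$, and fixed subsets $\mathcal{A},\mathcal{B}\subseteq\mathcal{R}$. Let $Q$ be a random variable on a finite set $\mathcal{Q}$ with $|\mathcal{Q}|\le 3m+2$, and consider any joint distribution of the form $$p(q)\,p^{(1)}(x_a|q)\,p^{(1)}(x_b|q)\,p^{(1)}(y_{\mathcal{R}}|x_a,x_b)\,p^{(2)}(x_{\mathcal{A}\cap\mathcal{B}}|q)\,p^{(2)}(x_{\mathcal{A}\setminus\mathcal{B}}|q)\,p^{(2)}(x_{\mathcal{B}\setminus\mathcal{A}}|q)\,p^{(2)}(y_a,y_b|x_{\mathcal{A}\cup\mathcal{B}}),$$ where $p^{(1)}(y_{\mathcal R}|x_a,x_b)$ and $p^{(2)}(y_a,y_b|x_{\mathcal A\cup\mathcal B})$ are the channel laws (inputs of relays inside each of the three sets may be arbitrarily jointly distributed). Then every rate pair $(R_a,R_b)$ with $R_a,R_b\ge 0$ satisfying $$R_a<\min\Big\{\Delta_1\min_{r\in\mathcal{A}\cap\mathcal{B}}I(X_a^{(1)};Y_r^{(1)}|X_b^{(1)},Q),\ \Delta_1\min_{r\in\mathcal{A}\setminus\mathcal{B}}I(X_a^{(1)};Y_r^{(1)}|Q),\ \Delta_2 I(X_{\mathcal{A}}^{(2)};Y_b^{(2)}|Q)\Big\},$$ $$R_b<\min\Big\{\Delta_1\min_{r\in\mathcal{A}\cap\mathcal{B}}I(X_b^{(1)};Y_r^{(1)}|X_a^{(1)},Q),\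 \Delta_1\min_{r\in\mathcal{B}\setminus\mathcal{A}}I(X_b^{(1)};Y_r^{(1)}|Q),\ \Delta_2 I(X_{\mathcal{B}}^{(2)};Y_a^{(2)}|Q)\Big\},$$ $$R_a+R_b<\Delta_1\min_{r\in\mathcal{A}\cap\mathcal{B}}I(X_a^{(1)},X_b^{(1)};Y_r^{(1)}|Q)$$ is achievable; i.e. the closure of the set of such pairs is an achievable rate region.
   Context: Network: nodes $r_0=a$, $r_{m+1}=b$ (terminals) and relays $\mathcal{R}=\{r_1,\dots,r_m\}$. Each node $r$ has finite input alphabet $\mathcal{X}_r$ and finite output alphabet $\mathcal{Y}_r$; a special symbol $\varnothing$ means ''no input/no output''. A protocol with $t$ phases specifies for each phase $\ell$ a set $T_\ell$ of transmitting nodes; nodes not in $T_\ell$ receive (half-duplex: transmitters have output $\varnothing$, receivers have input $\varnothing$), and during phase $\ell$ the channel is discrete memoryless with law $p^{(\ell)}(y_{\text{receivers}}|x_{T_\ell})$. $X_r^{(\ell)},Y_r^{(\ell)}$ denote the input/output of node $r$ in a generic channel use of phase $\ell$, and $X_S^{(\ell)}=\{X_r^{(\ell)}:r\in S\}$; variables equal to $\varnothing$ are dropped from information quantities (so a mutual information with empty input set is $0$). Messages $W_a$ (at $a$, wanted at $b$) and $W_b$ (at $b$, wanted at $a$) are independent and uniform on $\{0,\dots,\lfloor 2^{nR_a}\rfloor-1\}$ and $\{0,\dots,\lfloor 2^{nR_b}\rfloor-1\}$. A code of length $n$ with phase durations $(\Delta_\ell)$ assigns $n_\ell$ channel uses to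 phase $\ell$ ($\sum n_\ell=n$); each transmitting node's input at time $k$ is a function of its own message (if any) and its previously received outputs; $a$ decodes $\tilde W_b$ from its outputs and $W_a$, and $b$ decodes $\tilde W_a$ similarly. $(R_a,R_b)$ is achievable if there are codes with $n_\ell/n\to\Delta_\ell$ for all $\ell$ and both error probabilities $\to 0$. The $(m,2)$ DF MABC protocol: phase 1, $T_1=\{a,b\}$ and the relays receive via $p^{(1)}(y_{\mathcal R}|x_a,x_b)$; phase 2, the relays in $\mathcal{A}\cup\mathcal{B}$ transmit and $a,b$ receive via $p^{(2)}(y_a,y_b|x_{\mathcal{A}\cup\mathcal{B}})$. A minimum over an empty index set is $+\infty$ (the corresponding constraint is absent). *)

(* Defs.v *)
From HB Require Import structures.
From mathcomp Require Import all_boot all_order all_algebra.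
From mathcomp Require Import all_classical all_reals all_analysis.
Set Implicit Arguments. Unset Strict Implicit. Unset Printing Implicit Defensive.
Import Order.TTheory GRing.Theory Num.Theory.
Import numFieldNormedType.Exports.
Local Open Scope classical_set_scope.
Local Open Scope ring_scope.

Definition log2 {R : realType} (x : R) : R := ln x / ln 2.

Definition is_pmf {R : realType} {T : finType} (p : T -> R) : Prop :=
  (forall t, 0 <= p t) /\ \sum_(t : T) p t = 1.

Definition law {R : realType} {Om T : finType} (P : Om -> R) (V : Om -> T)
  (t : T) : R := \sum_(w : Om | V w == t) P w.

(* entropy H(V) (convention 0 log 0 = 0 is automatic since 0 * _ = 0) *)
Definition entropy {R : realType} {Om T : finType} (P : Om -> R) (V : Om -> T)
  : R := - \sum_(t : T) law P V t * log2 (law P V t).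

Definition centropy {R : realType} {Om T U : finType} (P : Om -> R)
  (V : Om -> T) (Z : Om -> U) : R :=
  entropy P (fun w => (V w, Z w)) - entropy P Z.

Definition cmi {R : realType} {Om T T' U : finType} (P : Om -> R)
  (V : Om -> T) (W : Om -> T') (Z : Om -> U) : R :=
  centropy P V Z - centropy P V (fun w => (W w, Z w)).

Definition relays (m : nat) (S : {set 'I_m}) : finType :=
  {r : 'I_m | r \in S}.

Definition inS (m : nat) (X : 'I_m -> finType) (S : {set 'I_m}) : finType :=
  {dffun forall s : relays S, X (val s)}.

Definition outR (m : nat) (Y : 'I_m -> finType) : finType :=
  {dffun forall r : 'I_m, Y r}.

(* phase-2 transmitted input x_{A u B}, split (bijectively) into the
   three blocks  x_{A n B}, x_{A \ B}, x_{B \ A} *)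
Definition in2 (m : nat) (X : 'I_m -> finType) (A B : {set 'I_m}) : finType :=
  (inS X (A :&: B) * inS X (A :\: B) * inS X (B :\: A))%type.

Record mabc_code (m : nat) (X Y : 'I_m -> finType) (Xa Xb Ya Yb : finType)
    (A B : {set 'I_m}) (n1 n2 Ma Mb : nat) := MabcCode {
  enc_a : 'I_Ma -> {ffun 'I_n1 -> Xa};
  enc_b : 'I_Mb -> {ffun 'I_n1 -> Xb};
  rel_AB : forall s : relays (A :&: B),
      {ffun 'I_n1 -> Y (val s)} -> {ffun 'I_n2 -> X (val s)};
  rel_A : forall s : relays (A :\: B),
      {ffun 'I_n1 -> Y (val s)} -> {ffun 'I_n2 -> X (val s)};
  rel_B : forall s : relays (B :\: A),
      {ffun 'I_n1 -> Y (val s)} -> {ffun 'I_n2 -> X (val s)};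
  dec_a : 'I_Ma -> {ffun 'I_n2 -> Ya} -> 'I_Mb;
  dec_b : 'I_Mb -> {ffun 'I_n2 -> Yb} -> 'I_Ma }.

Arguments rel_AB {m X Y Xa Xb Ya Yb A B n1 n2 Ma Mb} _ s _.
Arguments rel_A {m X Y Xa Xb Ya Yb A B n1 n2 Ma Mb} _ s _.
Arguments rel_B {m X Y Xa Xb Ya Yb A B n1 n2 Ma Mb} _ s _.

Section CodeSemantics.
Variables (R : realType) (m : nat) (X Y : 'I_m -> finType)
  (Xa Xb Ya Yb : finType) (A B : {set 'I_m}) (n1 n2 Ma Mb : nat).
Variable C : mabc_code X Y Xa Xb Ya Yb A B n1 n2 Ma Mb.

Definition relay_obs (y1 : {ffun 'I_n1 -> outR Y}) (r : 'I_m)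
  : {ffun 'I_n1 -> Y r} := [ffun j => y1 j r].

Definition x2_of (y1 : {ffun 'I_n1 -> outR Y}) (k : 'I_n2) : in2 X A B :=
  (finfun (fun s : relays (A :&: B) => rel_AB C s (relay_obs y1 (val s)) k)
     : inS X (A :&: B),
   finfun (fun s : relays (A :\: B) => rel_A C s (relay_obs y1 (val s)) k)
     : inS X (A :\: B),
   finfun (fun s : relays (B :\: A) => rel_B C s (relay_obs y1 (val s)) k)
     : inS X (B :\: A)).

Variables (W1 : Xa -> Xb -> outR Y -> R) (W2 : in2 X A B -> Ya * Yb -> R).

Definition code_prob
  (bad : 'I_Ma -> 'I_Mb -> {ffun 'I_n2 -> Ya * Yb} -> bool) : R :=
  ((Ma * Mb)%:R)^-1 *
  \sum_(wa : 'I_Ma) \sum_(wb : 'I_Mb)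
  \sum_(y1 : {ffun 'I_n1 -> outR Y}) \sum_(y2 : {ffun 'I_n2 -> Ya * Yb})
    (\prod_(k : 'I_n1) W1 (enc_a C wa k) (enc_b C wb k) (y1 k)) *
    (\prod_(k : 'I_n2) W2 (x2_of y1 k) (y2 k)) *
    (bad wa wb y2)%:R.

Definition err_at_a : R :=
  code_prob (fun wa wb y2 => dec_a C wa [ffun k => (y2 k).1] != wb).

Definition err_at_b : R :=
  code_prob (fun wa wb y2 => dec_b C wb [ffun k => (y2 k).2] != wa).

End CodeSemantics.

Definition nmsg {R : realType} (rate : R) (n : nat) : nat :=
  Num.truncn (2 `^ (n%:R * rate)).

Definition achievable {R : realType} (m : nat) (X Y : 'I_m -> finType)
  (Xa Xb Ya Yb : finType) (A B : {set 'I_m})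
  (W1 : Xa -> Xb -> outR Y -> R) (W2 : in2 X A B -> Ya * Yb -> R)
  (D1 D2 Ra Rb : R) : Prop :=
  exists (n1 n2 : nat -> nat)
    (C : forall n, mabc_code X Y Xa Xb Ya Yb A B (n1 n) (n2 n)
                     (nmsg Ra n) (nmsg Rb n)),
    (forall n, (n1 n + n2 n)%N = n) /\
    ((fun n : nat => (n1 n)%:R / n%:R : R) @ \oo --> D1) /\
    ((fun n : nat => (n2 n)%:R / n%:R : R) @ \oo --> D2) /\
    ((fun n : nat => err_at_a (C n) W1 W2) @ \oo --> (0 : R)) /\
    ((fun n : nat => err_at_b (C n) W1 W2) @ \oo --> (0 : R)).

Definition omega (m : nat) (X Y : 'I_m -> finType) (Xa Xb Ya Yb : finType)
  (A B : {set 'I_m}) (Q : finType) : finType :=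
  (Q * Xa * Xb * outR Y * in2 X A B * (Ya * Yb))%type.

Section JointLaw.
Variables (R : realType) (m : nat) (X Y : 'I_m -> finType)
  (Xa Xb Ya Yb : finType) (A B : {set 'I_m}) (Q : finType).
Local Notation Om := (omega X Y Xa Xb Ya Yb A B Q).

Definition joint_pmf (pQ : Q -> R) (pa : Q -> Xa -> R) (pb : Q -> Xb -> R)
  (W1 : Xa -> Xb -> outR Y -> R)
  (pAB : Q -> inS X (A :&: B) -> R) (pAo : Q -> inS X (A :\: B) -> R)
  (pBo : Q -> inS X (B :\: A) -> R) (W2 : in2 X A B -> Ya * Yb -> R)
  (w : Om) : R :=
  let: (q, xa, xb, yR, (xab, xao, xbo), y2) := w in
  pQ q * pa q xa * pb q xb * W1 xa xb yR *
  pAB q xab * pAo q xao * pBo q xbo * W2 (xab, xao, xbo) y2.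

Definition rvQ (w : Om) : Q := w.1.1.1.1.1.
Definition rvXa (w : Om) : Xa := w.1.1.1.1.2.
Definition rvXb (w : Om) : Xb := w.1.1.1.2.
Definition rvYr (r : 'I_m) (w : Om) : Y r := w.1.1.2 r.
(* X_A^{(2)} = (x_{A n B}, x_{A \ B}),  X_B^{(2)} = (x_{A n B}, x_{B \ A}) *)
Definition rvXA (w : Om) := (w.1.2.1.1, w.1.2.1.2).
Definition rvXB (w : Om) := (w.1.2.1.1, w.1.2.2).
Definition rvYa (w : Om) : Ya := w.2.1.
Definition rvYb (w : Om) : Yb := w.2.2.
End JointLaw.

(* Main.v *)
(* Random coding with time sharing. The codebooks are drawn at random, phase-1
   codewords from p(x_a|q) p(x_b|q) and phase-2 codewords from the block laws
   given q, the block of A :&: B being indexed by the pair of messages. Each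
   relay of A :&: B decodes both messages as a multiple-access receiver, each
   relay of A :\: B (resp. B :\: A) decodes w_a (resp. w_b) treating the other
   codeword as noise, and each terminal decodes the other message from phase 2
   knowing its own. All decoders look for a message tuple whose product of
   likelihood ratios p(v|y,z)/p(v|z) exceeds exp(n th), with th strictly between
   the rate and the mutual information (suitably scaled). By Chebyshev's
   inequality the true tuple passes with probability 1 - O(1/n); by Markov's
   inequality a wrong tuple passes with probability at most exp(-n th), since
   its likelihood ratio has mean at most 1. The union bound gives a vanishing
   average error, so some codebook does as well. *)

Require Import Defs.
From HB Require Import structures.
From mathcomp Require Import all_boot all_order all_algebra.
From mathcomp Require Import all_classical all_reals all_analysis.
From mathcomp Require Import ring lra.
Import Order.TTheory GRing.Theory Num.Theory.
Import numFieldNormedType.Exports.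
Local Open Scope classical_set_scope.
Local Open Scope ring_scope.

Set Implicit Arguments. Unset Strict Implicit. Unset Printing Implicit Defensive.

(** * Finite expectations *)

Section Expectation.
Variable R : realType.

Definition Ex {T : finType} (p f : T -> R) : R := \sum_t p t * f t.

Definition iid {I S : finType} (p : S -> R) (s : {ffun I -> S}) : R :=
  \prod_i p (s i).

(** The law of the output word of the memoryless channel [W] fed with the word [s]. *)
Definition kprod {I S T : finType} (W : S -> T -> R)
  (s : {ffun I -> S}) (y : {ffun I -> T}) : R := \prod_i W (s i) (y i).

Section One.
Variables (T : finType) (p : T -> R).
Implicit Types f g : T -> R.

Lemma eq_Ex f g : f =1 g -> Ex p f = Ex p g.
Proof. by move=> fg; apply: eq_bigr => t _; rewrite fg. Qed.

Lemma ExD f g : Ex p (fun t => f t + g t) = Ex p f + Ex p g.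
Proof. by rewrite /Ex -big_split; apply: eq_bigr => t _; rewrite mulrDr. Qed.

Lemma ExZ a f : Ex p (fun t => a * f t) = a * Ex p f.
Proof. by rewrite /Ex mulr_sumr; apply: eq_bigr => t _; rewrite mulrCA. Qed.

Lemma ExZr a f : Ex p (fun t => f t * a) = Ex p f * a.
Proof. by rewrite mulrC -ExZ; apply: eq_Ex => t; rewrite mulrC. Qed.

Lemma Ex_sum (I : Type) (r : seq I) (Q : pred I) (F : I -> T -> R) :
  Ex p (fun t => \sum_(i <- r | Q i) F i t) = \sum_(i <- r | Q i) Ex p (F i).
Proof.
rewrite /Ex exchange_big; apply: eq_bigr => t _.
by rewrite mulr_sumr.
Qed.

Hypothesis hp : is_pmf p.

Lemma Ex_const c : Ex p (fun=> c) = c.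
Proof. by rewrite /Ex -mulr_suml hp.2 mul1r. Qed.

Lemma Ex_eq_const f c : (forall t, f t = c) -> Ex p f = c.
Proof. by move=> fc; rewrite -[RHS]Ex_const; apply: eq_Ex. Qed.

Lemma le_Ex f g : (forall t, 0 < p t -> f t <= g t) -> Ex p f <= Ex p g.
Proof.
move=> fg; apply: ler_sum => t _.
have := hp.1 t; rewrite le_eqVlt => /orP[/eqP<-|pt]; first by rewrite !mul0r.
by rewrite ler_pM2l // fg.
Qed.

Lemma Ex_ge0 f : (forall t, 0 <= f t) -> 0 <= Ex p f.
Proof. by move=> f0; apply: sumr_ge0 => t _; rewrite mulr_ge0 // hp.1. Qed.

(** If every value exceeded [b], so would the mean; strictness comes from an outcome of positive
    mass. This extracts a codebook from an average over codebooks. *)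
Lemma Ex_pick f b : Ex p f <= b -> exists t, f t <= b.
Proof.
move=> fb; apply/existsP; apply: contraLR fb => /existsPn nf.
rewrite -ltNge -[ltLHS]Ex_const /Ex.
have [t0 pt0] : exists t, 0 < p t.
  apply/existsP; apply: contraT => /existsPn np.
  have := hp.2; rewrite big1 => [/esym/eqP|t _]; first by rewrite oner_eq0.
  by apply/eqP; rewrite eq_le hp.1 leNgt np.
rewrite (bigD1 t0) //= [ltRHS](bigD1 t0) //= ltr_leD //.
  by rewrite ltr_pM2l // ltNge nf.
by apply: ler_sum => t _; rewrite ler_wpM2l ?hp.1 // ltW // ltNge nf.
Qed.

Lemma markov_Ex f (a : R) : 0 < a -> (forall t, 0 <= f t) ->
  Ex p (fun t => (a <= f t)%R%:R) <= Ex p f / a.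
Proof.
move=> a0 f0; rewrite -ExZr; apply: le_Ex => t _.
case: (leP a) => [af|_] /=; last by rewrite divr_ge0 // ltW.
by rewrite ler_pdivlMr // mul1r.
Qed.

End One.

Lemma Ex_exch (S T : finType) (p : S -> R) (q : T -> R) F :
  Ex p (fun x => Ex q (fun y => F x y)) = Ex q (fun y => Ex p (fun x => F x y)).
Proof.
rewrite /Ex; under eq_bigr do rewrite mulr_sumr.
rewrite exchange_big /=; apply: eq_bigr => y _.
by rewrite mulr_sumr; apply: eq_bigr => x _; rewrite mulrCA.
Qed.

Section Two.
Variables (S T : finType) (p : S -> R) (W : S -> T -> R).
Implicit Types F G : S -> T -> R.

Lemma Ex2D F G : Ex p (fun s => Ex (W s) (fun t => F s t + G s t)) =
  Ex p (fun s => Ex (W s) (F s)) + Ex p (fun s => Ex (W s) (G s)).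
Proof. by rewrite -ExD; apply: eq_Ex => s; rewrite -ExD. Qed.

Lemma Ex2_sum (I : Type) (r : seq I) (Q : pred I) (F : I -> S -> T -> R) :
  Ex p (fun s => Ex (W s) (fun t => \sum_(i <- r | Q i) F i s t)) =
  \sum_(i <- r | Q i) Ex p (fun s => Ex (W s) (F i s)).
Proof. by rewrite -Ex_sum; apply: eq_Ex => s; rewrite -Ex_sum. Qed.

Lemma le_Ex2 F G : is_pmf p -> (forall s, is_pmf (W s)) ->
  (forall s t, F s t <= G s t) ->
  Ex p (fun s => Ex (W s) (F s)) <= Ex p (fun s => Ex (W s) (G s)).
Proof.
by move=> hp hW FG; apply: le_Ex => // s _; apply: le_Ex => // t _.
Qed.

End Two.

Lemma Ex_pair (S T : finType) (p : S -> R) (W : S -> T -> R) F :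
  Ex (fun s => p s.1 * W s.1 s.2) F = Ex p (fun x => Ex (W x) (fun y => F (x, y))).
Proof.
rewrite /Ex; under [RHS]eq_bigr do rewrite mulr_sumr.
by rewrite pair_bigA /=; apply: eq_bigr => -[x y] _ /=; rewrite mulrA.
Qed.

(** * Independent letters and memoryless channels *)

Section Iid.
Variables (I S : finType) (p : S -> R).
Hypothesis hp : is_pmf p.

Lemma Ex_iid_prod (h : I -> S -> R) :
  Ex (iid p) (fun s : {ffun I -> S} => \prod_i h i (s i)) = \prod_i Ex p (h i).
Proof.
rewrite /Ex /iid bigA_distr_bigA /=.
by apply: eq_bigr => s _; rewrite -big_split.
Qed.

Lemma iid_pmf : is_pmf (@iid I S p).
Proof.
split=> [s|]; first by apply: prodr_ge0 => i _; apply: hp.1.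
transitivity (Ex (iid p) (fun s : {ffun I -> S} => \prod_(i : I) 1)).
  by apply: eq_bigr => s _; rewrite big1 ?mulr1.
by rewrite (Ex_iid_prod (fun=> fun=> 1)) big1 // => i _; rewrite Ex_const.
Qed.

Lemma Ex_ind (x : S) : Ex p (fun t => (t == x)%:R) = p x.
Proof.
rewrite /Ex (bigD1 x) //= eqxx mulr1 big1 ?addr0 // => t /negPf->.
by rewrite mulr0.
Qed.

Lemma sum_ind (F : S -> R) y : F y = \sum_x (y == x)%:R * F x.
Proof.
rewrite (bigD1 y) //= eqxx mul1r big1 ?addr0 // => x.
by rewrite eq_sym => /negPf->; rewrite mul0r.
Qed.

(** Expanding [F] over indicators of [s i] and [s j] makes each term a product over coordinates,
    which [Ex_iid_prod] factors. *)
Lemma Ex_iid2 (i j : I) (F : S -> S -> R) : i != j ->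
  Ex (iid p) (fun s : {ffun I -> S} => F (s i) (s j)) =
  Ex p (fun x => Ex p (fun y => F x y)).
Proof.
move=> ij.
transitivity (\sum_x \sum_y
    Ex (iid p) (fun s : {ffun I -> S} => (s i == x)%:R * (s j == y)%:R) * F x y).
  under eq_bigr do under eq_bigr do rewrite -ExZr.
  under eq_bigr do rewrite -Ex_sum.
  rewrite -Ex_sum; apply: eq_Ex => s.
  rewrite (sum_ind (F^~ (s j))); apply: eq_bigr => x _.
  rewrite (sum_ind (F x)) mulr_sumr; apply: eq_bigr => y _.
  by rewrite mulrA.
rewrite /Ex; apply: eq_bigr => x _; rewrite mulr_sumr; apply: eq_bigr => y _.
rewrite mulrA; congr (_ * _).
(* One factor per coordinate: an indicator at [i] and at [j], the constant 1 elsewhere. *)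
pose h k t : R := if k == i then (t == x)%:R else if k == j then (t == y)%:R else 1.
transitivity (Ex (iid p) (fun s : {ffun I -> S} => \prod_k h k (s k))).
  apply: eq_Ex => s; rewrite (bigD1 i) //= (bigD1 j) /=; last by rewrite eq_sym.
  rewrite big1.
    by rewrite /h eqxx (eq_sym j i) (negPf ij) eqxx mulr1.
  by move=> k /andP[/negPf ki /negPf kj]; rewrite /h ki kj.
rewrite Ex_iid_prod (bigD1 i) //= (bigD1 j) /=; last by rewrite eq_sym.
rewrite big1.
  by rewrite /h eqxx (eq_sym j i) (negPf ij) eqxx mulr1 !Ex_ind.
move=> k /andP[/negPf ki /negPf kj]; rewrite /h ki kj; exact: Ex_const.
Qed.

Lemma Ex_iid1 (i : I) (F : S -> R) :
  Ex (iid p) (fun s : {ffun I -> S} => F (s i)) = Ex p F.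
Proof.
transitivity (\sum_x
    Ex (iid p) (fun s : {ffun I -> S} => (s i == x)%:R) * F x).
  under eq_bigr do rewrite -ExZr.
  by rewrite -Ex_sum; apply: eq_Ex => s; rewrite (sum_ind F).
apply: eq_bigr => x _; congr (_ * _).
pose h k t : R := if k == i then (t == x)%:R else 1.
transitivity (Ex (iid p) (fun s : {ffun I -> S} => \prod_k h k (s k))).
  apply: eq_Ex => s; rewrite (bigD1 i) //= big1 ?mulr1 /h ?eqxx //.
  by move=> k /negPf ->.
rewrite Ex_iid_prod (bigD1 i) //= big1 ?mulr1 /h ?eqxx ?Ex_ind //.
by move=> k /negPf ->; exact: Ex_const.
Qed.

End Iid.

Lemma kprod_pmf (I S T : finType) (W : S -> T -> R) (s : {ffun I -> S}) :
  (forall x, is_pmf (W x)) -> is_pmf (kprod W s).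
Proof.
move=> hW; split=> [y|]; first by apply: prodr_ge0 => i _; apply: (hW _).1.
rewrite /kprod -(bigA_distr_bigA (fun i => W (s i))) big1 // => i _.
exact: (hW _).2.
Qed.

(** An i.i.d. input word sent through a memoryless channel gives an i.i.d. word of input-output
    pairs, so bounds for i.i.d. sequences apply to both at once. *)
Lemma Ex_kprod (I S T : finType) (p : S -> R) (W : S -> T -> R)
    (F : {ffun I -> S} -> {ffun I -> T} -> R) :
  Ex (iid p) (fun s => Ex (kprod W s) (F s)) =
  Ex (iid (fun z : S * T => p z.1 * W z.1 z.2))
     (fun z => F [ffun i => (z i).1] [ffun i => (z i).2]).
Proof.
rewrite /Ex; under eq_bigr do rewrite mulr_sumr.
rewrite pair_bigA /=.
rewrite (reindex (fun z : {ffun I -> S * T} =>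
  ([ffun i => (z i).1], [ffun i => (z i).2]))) /=.
  apply: eq_bigr => z _; rewrite mulrA; congr (_ * _).
  rewrite /iid /kprod -big_split; apply: eq_bigr => i _.
  by rewrite !ffunE.
exists (fun u : {ffun I -> S} * {ffun I -> T} => [ffun i => (u.1 i, u.2 i)]) => [z _|[s y] _].
  by apply/ffunP => i; rewrite !ffunE; case: (z i).
by congr pair; apply/ffunP => i; rewrite !ffunE.
Qed.

Lemma pair_pmf (S T : finType) (p : S -> R) (W : S -> T -> R) :
  is_pmf p -> (forall x, is_pmf (W x)) ->
  is_pmf (fun z : S * T => p z.1 * W z.1 z.2).
Proof.
move=> hp hW; split=> [z|]; first by rewrite mulr_ge0 ?hp.1 ?(hW _).1.
transitivity (Ex (fun z : S * T => p z.1 * W z.1 z.2) (fun=> 1)).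
  by apply: eq_bigr => z _; rewrite mulr1.
rewrite Ex_pair -[RHS](Ex_const hp); apply: eq_Ex => x.
exact: Ex_const.
Qed.

(** * Chebyshev's inequality for i.i.d. sums *)

Section Chebyshev.
Variables (S : finType) (p : S -> R).
Hypothesis hp : is_pmf p.

(** Distinct coordinates are independent with mean zero, so only the [n] diagonal terms of the
    expanded square survive. *)
Lemma Ex_sum_sqr n (f : S -> R) : Ex p f = 0 ->
  Ex (iid p) (fun s : {ffun 'I_n -> S} => (\sum_k f (s k)) ^+ 2) =
  n%:R * Ex p (fun t => f t ^+ 2).
Proof.
move=> f0.
transitivity (\sum_(i < n) \sum_(j < n)
    Ex (iid p) (fun s : {ffun 'I_n -> S} => f (s i) * f (s j))).
  under eq_bigr do rewrite -Ex_sum.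
  rewrite -Ex_sum; apply: eq_Ex => s.
  rewrite expr2 mulr_suml; apply: eq_bigr => i _.
  by rewrite mulr_sumr.
transitivity (\sum_(i < n) Ex p (fun t => f t ^+ 2)); last first.
  by rewrite sumr_const card_ord mulr_natl.
apply: eq_bigr => i _; rewrite (bigD1 i) //= big1 ?addr0.
  rewrite -(Ex_iid1 hp i); apply: eq_Ex => s; by rewrite expr2.
move=> j ji; rewrite (Ex_iid2 hp (fun x y => f x * f y)) 1?eq_sym //.
under eq_Ex do rewrite ExZ f0 mulr0.
exact: Ex_const.
Qed.

(** Chebyshev's inequality gives the variance over [n * d ^+ 2]; dividing by [n.+1] instead, with an
    enlarged numerator, keeps the bound valid at [n = 0]. *)
Lemma chebyshev_iid n (f : S -> R) (d : R) : 0 < d ->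
  Ex (iid p) (fun s : {ffun 'I_n -> S} =>
    (\sum_k f (s k) <= n%:R * (Ex p f - d))%R%:R) <=
  (2 * (Ex p (fun t => (f t - Ex p f) ^+ 2) / d ^+ 2) + 1) / n.+1%:R.
Proof.
move=> d0; set mu := Ex p f; set v := Ex p _.
pose g t := f t - mu.
have g0 : Ex p g = 0.
  by rewrite /g ExD Ex_const // subrr.
have v0 : 0 <= v by apply: Ex_ge0 => // t; rewrite sqr_ge0.
(* At [n = 0] the right side is at least 1, so the bound is trivial. *)
case: n => [|n].
  rewrite divr1; apply: le_trans (_ : 1 <= _).
    rewrite -[leRHS](Ex_const (iid_pmf 'I_0 hp)); apply: le_Ex => [|s _].
      exact: iid_pmf.
    by rewrite lern1 leq_b1.
  by rewrite lerDr mulr_ge0 ?divr_ge0 // sqr_ge0.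
set N : R := n.+1%:R.
have N0 : 0 < N by rewrite ltr0n.
have hi := iid_pmf 'I_n.+1 hp.
have E : Ex (iid p) (fun s : {ffun 'I_n.+1 -> S} => (\sum_k g (s k)) ^+ 2) = N * v.
  exact: Ex_sum_sqr.
apply: le_trans (_ : N * v / (N * d) ^+ 2 <= _).
  rewrite -E; apply: le_trans (markov_Ex hi _ _); last 2 first.
  - by rewrite exprn_gt0 // mulr_gt0.
  - by move=> s; rewrite sqr_ge0.
  apply: le_Ex => // s _; rewrite ler_nat.
  case: (leP (\sum_k _) _) => //= h.
  have -> : \sum_k g (s k) = \sum_k f (s k) - N * mu.
    by rewrite big_split /= sumr_const card_ord mulNrn mulr_natl.
  (* A sum at most [N * (mu - d)] deviates from its mean by at least [N * d]. *)
  suff -> : (N * d) ^+ 2 <= (\sum_k f (s k) - N * mu) ^+ 2 by [].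
  rewrite -[leRHS]sqrrN ler_sqr ?nnegrE; nra.
rewrite -[n.+2%:R](natrD _ 1 n.+1) -/N ler_pdivlMr; last by rewrite addr_gt0.
have -> : N * v / (N * d) ^+ 2 * (1 + N) = v / d ^+ 2 + v / d ^+ 2 / N.
  by field; rewrite !gt_eqF.
have N1 : 1 <= N by rewrite ler1n.
have vd0 : 0 <= v / d ^+ 2 by rewrite divr_ge0 ?sqr_ge0.
have h : v / d ^+ 2 / N <= v / d ^+ 2 by rewrite ler_pdivrMr // ler_peMr.
by rewrite mulr2n mulrDl !mul1r -addrA lerD2l (le_trans h) // lerDl.
Qed.

End Chebyshev.
End Expectation.

(** * Likelihood-ratio tests *)

Section Density.
Variable R : realType.

Section Law.
Variables (Om : finType) (P : Om -> R).
Hypothesis hP : is_pmf P.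

Lemma law_ge0 (T : finType) (V : Om -> T) t : 0 <= law P V t.
Proof. by apply: sumr_ge0 => w _; apply: hP.1. Qed.

Lemma law_gt0 (T : finType) (V : Om -> T) w : 0 < P w -> 0 < law P V (V w).
Proof.
move=> Pw; rewrite /law (bigD1 w) //= ltr_pwDl // sumr_ge0 // => u _.
exact: hP.1.
Qed.

Lemma Ex_law (T : finType) (V : Om -> T) (h : T -> R) :
  Ex P (fun w => h (V w)) = Ex (law P V) h.
Proof.
rewrite /Ex (partition_big V predT) //=; apply: eq_bigr => t _.
by rewrite /law mulr_suml; apply: eq_bigr => w /eqP->.
Qed.

Lemma law_Ex (T : finType) (V : Om -> T) t :
  law P V t = Ex P (fun w => (V w == t)%:R).
Proof.
rewrite /law /Ex big_mkcond; apply: eq_bigr => w _.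
by case: eqP; rewrite ?mulr1 ?mulr0.
Qed.

Lemma entropy_Ex (T : finType) (V : Om -> T) :
  entropy P V = - Ex P (fun w => log2 (law P V (V w))).
Proof. by rewrite (Ex_law V (fun t => log2 (law P V t))). Qed.

End Law.

Section Triple.
Variables (Om T U Z : finType) (P : Om -> R).
Variables (V : Om -> T) (Y : Om -> U) (C : Om -> Z).
Hypothesis hP : is_pmf P.

(* p(v, y | c) / (p(v | c) p(y | c)), equal to 0 wherever a denominator vanishes. *)
Definition dens (v : T) (y : U) (c : Z) : R :=
  law P (fun w => (V w, (Y w, C w))) (v, (y, c)) * law P C c /
  (law P (fun w => (V w, C w)) (v, c) * law P (fun w => (Y w, C w)) (y, c)).

Let d w := dens (V w) (Y w) (C w).

Lemma dens_ge0 v y c : 0 <= dens v y c.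
Proof. by rewrite divr_ge0 ?mulr_ge0 ?law_ge0. Qed.

Lemma dens_gt0 w : 0 < P w -> 0 < d w.
Proof.
move=> Pw; rewrite divr_gt0 ?mulr_gt0 //.
- exact: (law_gt0 hP (fun w => (V w, (Y w, C w)))).
- exact: law_gt0.
- exact: (law_gt0 hP (fun w => (V w, C w))).
- exact: (law_gt0 hP (fun w => (Y w, C w))).
Qed.

(** The four entropies merge into one expectation of logarithms; wherever [P] is positive all four
    laws are positive and the logarithm of the quotient splits. The factor [ln 2] turns bits into
    nats. *)
Lemma cmi_dens : ln 2 * cmi P V Y C = Ex P (fun w => ln (d w)).
Proof.
have ln2 : ln 2 != 0 :> R by rewrite gt_eqF // ln_gt0 // ltr1n.
rewrite /cmi /centropy !entropy_Ex //.
transitivity (ln 2 * Ex P (fun w => log2 (d w))); last first.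
  rewrite -ExZ; apply: eq_Ex => w; rewrite /log2 mulrC.
  by rewrite divfK.
congr (_ * _).
set a := Ex P _; set b := Ex P _; set c := Ex P _; set e := Ex P _.
transitivity (c + (b - a - e)); last first.
  rewrite /a /b /c /e /Ex -!sumrN -!big_split /=; apply: eq_bigr => w _.
  rewrite -!mulrN -!mulrDr.
  have := hP.1 w; rewrite le_eqVlt => /orP[/eqP<-|Pw]; first by rewrite !mul0r.
  congr (_ * _); rewrite /d /dens /log2.
  have h1 := law_gt0 hP (fun w => (V w, (Y w, C w))) Pw.
  have h2 := law_gt0 hP C Pw.
  have h3 := law_gt0 hP (fun w => (V w, C w)) Pw.
  have h4 := law_gt0 hP (fun w => (Y w, C w)) Pw.
  rewrite ln_div ?posrE ?mulr_gt0 // !lnM ?posrE //.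
  by field.
by ring.
Qed.

(** [k c] stands for the conditional law of [V] given [C = c], characterized through test
    functions. *)
Variable k : Z -> T -> R.
Hypothesis hVC : forall h : T -> Z -> R,
  Ex P (fun w => h (V w) (C w)) = Ex P (fun w => Ex (k (C w)) (fun v => h v (C w))).

(** When [V] is redrawn from [k] independently of [Y] given [C], the weights cancel the denominator
    of the density and leave the joint mass of [(V, Y, C)], of total 1; a point with a vanishing
    denominator contributes 0. *)
Lemma Ex_dens_le1 : Ex P (fun w => Ex (k (C w)) (fun v => dens v (Y w) (C w))) <= 1.
Proof.
rewrite (Ex_law P (fun w => (Y w, C w))
  (fun yc => Ex (k yc.2) (fun v => dens v yc.1 yc.2))).
have lVC v c : law P (fun w => (V w, C w)) (v, c) = k c v * law P C c.
  rewrite law_Ex (hVC (fun v' c' => ((v', c') == (v, c))%:R)) law_Ex -ExZ.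
  apply: eq_Ex => w.
  under eq_Ex do rewrite xpair_eqE -mulnb natrM.
  rewrite ExZr Ex_ind; case: eqP => [->//|]; by rewrite !mulr0.
have -> : (1 : R) = \sum_yc \sum_v law P (fun w => (V w, (Y w, C w))) (v, yc).
  rewrite exchange_big pair_bigA /=.
  transitivity (Ex P (fun=> 1)); first by rewrite Ex_const.
  rewrite (Ex_law P (fun w => (V w, (Y w, C w))) (fun=> 1)).
  by apply: eq_bigr => -[v yc] _; rewrite mulr1.
rewrite /Ex; apply: ler_sum => -[y c] _; rewrite mulr_sumr.
apply: ler_sum => v _ /=; rewrite /dens lVC.
set l1 := law _ _ _; set l2 := law _ _ _; set l3 := law _ _ _.
have l1_ge0 : 0 <= l1 by apply: law_ge0.
have l2_ge0 : 0 <= l2 by apply: law_ge0.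
have [->|l10] := eqVneq l1 0; first by rewrite mul0r.
have [->|l30] := eqVneq l3 0; first by rewrite !(mulr0,mul0r,invr0).
have [->|k0] := eqVneq (k c v) 0; first by rewrite !(mulr0,mul0r,invr0).
rewrite le_eqVlt; apply/orP; left; apply/eqP; field.
by rewrite l10 l30 k0.
Qed.

Section Test.
Variables (S S' : finType) (p : S -> R) (W : S -> S' -> R) (n : nat) (th : R).
Hypothesis hp : is_pmf p.
Hypothesis hW : forall s, is_pmf (W s).
Let q := fun z : S * S' => p z.1 * W z.1 z.2.

(** A product of densities rather than a sum of logarithms: one vanishing density makes the test
    fail, whereas [ln 0] would count as 0. *)
Definition test (v : 'I_n -> T) (y : 'I_n -> U) (c : 'I_n -> Z) : bool :=
  expR (n%:R * th) < \prod_k dens (v k) (y k) (c k).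

(** The bound of [chebyshev_iid] for the log-density, with the gap between the information in nats
    and [th] as deviation: a constant over [n.+1]. *)
Definition miss_bound : R := (2 * (Ex P (fun w => (ln (d w) - ln 2 * cmi P V Y C) ^+ 2)
   / (ln 2 * cmi P V Y C - th) ^+ 2) + 1) / n.+1%:R.

Variables (v : S -> S' -> T) (y : S -> S' -> U) (c : S -> S' -> Z).

(** The law hypothesis makes each letter a draw of [(V, Y, C)], so the log-densities are i.i.d. with
    mean above [th] and [chebyshev_iid] applies. *)
Lemma miss_le : th < ln 2 * cmi P V Y C ->
  (forall h : T -> U -> Z -> R,
     Ex p (fun s => Ex (W s) (fun t => h (v s t) (y s t) (c s t))) =
     Ex P (fun w => h (V w) (Y w) (C w))) ->
  Ex (iid p) (fun s : {ffun 'I_n -> S} => Ex (kprod W s) (fun t =>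
    (~~ test (fun i => v (s i) (t i)) (fun i => y (s i) (t i))
             (fun i => c (s i) (t i)))%:R)) <= miss_bound.
Proof.
move=> thI hv; rewrite Ex_kprod.
have hq : is_pmf q by apply: pair_pmf.
have hv' (h : T -> U -> Z -> R) :
    Ex q (fun z => h (v z.1 z.2) (y z.1 z.2) (c z.1 z.2)) =
    Ex P (fun w => h (V w) (Y w) (C w)).
  by rewrite Ex_pair /= hv.
set f := fun z : S * S' => ln (dens (v z.1 z.2) (y z.1 z.2) (c z.1 z.2)).
have Ef : Ex q f = ln 2 * cmi P V Y C.
  by rewrite (hv' (fun v y c => ln (dens v y c))) cmi_dens.
have d0 : 0 < Ex q f - th by rewrite Ef subr_gt0.
(* The threshold [th] is written as the mean minus the gap, the form that [chebyshev_iid] bounds. *)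
apply: (@le_trans _ _ (Ex (iid q) (fun s : {ffun 'I_n -> S * S'} =>
    (\sum_k f (s k) <= n%:R * (Ex q f - (Ex q f - th)))%R%:R))); last first.
  apply: le_trans (chebyshev_iid hq n f d0) _.
  rewrite /miss_bound Ef (hv' (fun v y c => (ln (dens v y c) - _) ^+ 2)).
  exact: lexx.
apply: le_Ex => [|z qz]; first exact: iid_pmf.
rewrite ler_nat opprB addrC subrK /test -leNgt.
under eq_bigr do rewrite !ffunE.
case: (leP (\prod_k _)) => //= hz.
suff -> : \sum_k f (z k) <= n%:R * th by [].
have q0 k' : 0 < q (z k').
  rewrite lt_neqAle hq.1 andbT eq_sym; apply/eqP => q0.
  have : iid q z = 0 by rewrite /iid (bigD1 k') //= q0 mul0r.
  by apply/eqP; rewrite gt_eqF.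
(* Logarithms are safe here: a zero density has probability zero under [P], hence under [q], while
   every letter of [z] has positive probability. *)
have dz k' : 0 < dens (v (z k').1 (z k').2) (y (z k').1 (z k').2) (c (z k').1 (z k').2).
  rewrite lt_neqAle dens_ge0 // andbT eq_sym; apply/eqP => dz0.
  have : Ex q (fun z => (dens (v z.1 z.2) (y z.1 z.2) (c z.1 z.2) == 0)%:R) = 0.
    rewrite (hv' (fun v y c => (dens v y c == 0)%:R)).
    rewrite /Ex big1 // => w _.
    have := hP.1 w; rewrite le_eqVlt => /orP[/eqP<-|Pw]; first by rewrite mul0r.
    by rewrite gt_eqF ?mulr0 // dens_gt0.
  move/eqP; rewrite /Ex psumr_eq0 => [|t _]; last by rewrite mulr_ge0 // hq.1.
  by move/allP/(_ (z k') (mem_index_enum _)); rewrite /= dz0 eqxx mulr1 gt_eqF.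
rewrite -ler_expR expR_sum; apply: le_trans hz.
by rewrite le_eqVlt; apply/orP; left; apply/eqP; apply: eq_bigr => i _; rewrite lnK ?posrE.
Qed.

(** Here [V] is redrawn from its conditional law, so each density has mean at most 1 by
    [Ex_dens_le1]; by independence so has the product, and Markov's inequality concludes. *)
Lemma false_alarm_le :
  (forall h : T -> U -> Z -> R,
     Ex p (fun s => Ex (W s) (fun t => h (v s t) (y s t) (c s t))) =
     Ex P (fun w => Ex (k (C w)) (fun v => h v (Y w) (C w)))) ->
  Ex (iid p) (fun s : {ffun 'I_n -> S} => Ex (kprod W s) (fun t =>
    (test (fun i => v (s i) (t i)) (fun i => y (s i) (t i))
             (fun i => c (s i) (t i)))%:R)) <= expR (- (n%:R * th)).
Proof.
move=> hv; rewrite Ex_kprod.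
have hq : is_pmf q by apply: pair_pmf.
pose g (i : 'I_n) := fun z : S * S' => dens (v z.1 z.2) (y z.1 z.2) (c z.1 z.2).
set G := Ex (iid q) (fun s : {ffun 'I_n -> S * S'} =>
    (expR (n%:R * th) <= \prod_(i < n) g i (s i))%R%:R).
apply: (@le_trans _ _ G).
  apply: le_Ex => [|z _]; first exact: iid_pmf.
  rewrite ler_nat /test; under eq_bigr do rewrite !ffunE.
  by case: (ltP (expR _)) => // /ltW; rewrite /g => ->.
apply: le_trans (markov_Ex (iid_pmf _ hq) _ _) _ => [||].
- exact: expR_gt0.
- by move=> s; apply: prodr_ge0 => i _; apply: dens_ge0.
rewrite expRN ler_piMl ?invr_ge0 ?expR_ge0 //.
rewrite Ex_iid_prod; apply: prodr_ile1 => i _.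
rewrite Ex_ge0 //=; last by move=> z; apply: dens_ge0.
by rewrite Ex_pair /= (hv dens) Ex_dens_le1.
Qed.
End Test.
End Triple.
End Density.

(** * Decoding by tests and the union bound *)

Section Decode.
Variables (T : finType) (t0 : T) (pass : pred T).

Definition decode_by : T := odflt t0 [pick t | pass t].

(** A wrong answer has two possible causes: the true candidate fails, which covers the fallback to
    [t0], or another candidate passes. *)
Lemma decode_by_err (R : realType) t :
  (decode_by != t)%:R <= (~~ pass t)%:R + \sum_(u | u != t) (pass u)%:R :> R.
Proof.
have S0 : 0 <= \sum_(u | u != t) (pass u)%:R :> R by apply: sumr_ge0.
rewrite /decode_by; case: pickP => [u pu /=|np]; last first.
  by rewrite np /= (le_trans (_ : _ <= 1)) ?lern1 ?leq_b1 // lerDl.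
have [_|ut] /= := eqVneq u t; first by rewrite addr_ge0.
rewrite (bigD1 u) //= pu addrCA lerDl addr_ge0 //.
by apply: sumr_ge0.
Qed.

End Decode.

(** Wrong pairs are sorted by which components are wrong, and each kind keeps only the test designed
    for it: [f] if the first alone is wrong, [g] if the second alone is, [h] if both are. *)
Lemma decode_by2_err (R : realType) (T T' : finType) (t0 t : T) (t0' t' : T')
    (f g h : T -> T' -> bool) :
  (decode_by (t0, t0') (fun u => [&& f u.1 u.2, g u.1 u.2 & h u.1 u.2]) != (t, t'))%:R <=
  (~~ f t t')%:R + (~~ g t t')%:R + (~~ h t t')%:R +
  \sum_(u | u != t) (f u t')%:R + \sum_(u' | u' != t') (g t u')%:R +
  \sum_(u | u != t) \sum_(u' | u' != t') (h u u')%:R :> R.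
Proof.
have e : (~~ [&& f t t', g t t' & h t t'])%:R <=
    (~~ f t t')%:R + (~~ g t t')%:R + (~~ h t t')%:R :> R.
  by rewrite -!natrD ler_nat; case: (f t t') (g t t') (h t t') => [] [] [].
apply: le_trans (decode_by_err _ _ _ _) _ => /=.
rewrite -2![leRHS]addrA; apply: lerD => //.
set c := \sum_(u | u != (t, t')) _.
rewrite /c (bigID (fun u => u.1 == t)) /=.
have -> : \sum_(u : T * T' | (u != (t, t')) && (u.1 == t))
    [&& f u.1 u.2, g u.1 u.2 & h u.1 u.2]%:R =
    \sum_(u' | u' != t') [&& f t u', g t u' & h t u']%:R :> R.
  rewrite (eq_bigl (fun u : T * T' => (u.1 == t) && (u.2 != t'))).
    rewrite -(pair_big (pred1 t) (fun u' => u' != t')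
      (fun u u' => [&& f u u', g u u' & h u u']%:R)) /=.
    by rewrite big_pred1_eq.
  by move=> [u u'] /=; rewrite xpair_eqE; case: (u == t); case: (u' == t').
have -> : \sum_(u : T * T' | (u != (t, t')) && (u.1 != t))
    [&& f u.1 u.2, g u.1 u.2 & h u.1 u.2]%:R =
    \sum_(u | u != t) [&& f u t', g u t' & h u t']%:R +
    \sum_(u | u != t) \sum_(u' | u' != t') [&& f u u', g u u' & h u u']%:R :> R.
  rewrite (eq_bigl (fun u : T * T' => (u.1 != t) && true)).
    rewrite -(pair_big (fun u => u != t) xpredT
      (fun u u' => [&& f u u', g u u' & h u u']%:R)) /=.
    by rewrite -big_split; apply: eq_bigr => u _; rewrite (bigD1 t').
  by move=> [u u'] /=; rewrite xpair_eqE; case: (u == t); case: (u' == t').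
rewrite [leLHS]addrCA; apply: lerD; last apply: lerD.
- by apply: ler_sum => u _; rewrite ler_nat; case: (f u t'); rewrite ?leq_b1.
- by apply: ler_sum => u' _; rewrite ler_nat; case: (f t u') (g t u') => [] []; rewrite ?leq_b1.
- apply: ler_sum => u _; apply: ler_sum => u' _; rewrite ler_nat.
  by case: (f u u') (g u u') => [] [].
Qed.

Lemma sum_le_card (R : realType) (n : nat) (Q : pred 'I_n) (F : 'I_n -> R) c :
  0 <= c -> (forall i, Q i -> F i <= c) -> \sum_(i | Q i) F i <= n%:R * c.
Proof.
move=> c0 Fc; rewrite -[n in n%:R]card_ord mulr_natl -sumr_const big_mkcond /=.
by apply: ler_sum => i _; case: ifP => // /Fc.
Qed.

(** * Message counts, thresholds and limits in the block length *)

Section Asymptotics.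
Variable R : realType.

Lemma nmsg_gt0 (r : R) n : 0 <= r -> (0 < nmsg r n)%N.
Proof.
move=> r0; rewrite /nmsg truncn_gt0 -[leLHS](powRr0 2).
by rewrite ler_powR ?ler1n // mulr_ge0.
Qed.

Lemma nmsg_le (r : R) n : (nmsg r n)%:R <= expR (n%:R * (r * ln 2)).
Proof.
rewrite mulrA; have -> : expR (n%:R * r * ln 2) = 2 `^ (n%:R * r).
  by rewrite /powR gt_eqF.
by rewrite truncn_le // powR_ge0.
Qed.

(* The midpoint of r / D and I, in nats: ln 2 converts from log2. *)
Definition threshold (D I r : R) : R := ln 2 * ((I + r / D) / 2).

(** Since [r] is nonnegative, [r < D * I] rules out [D = 0]; then [r / D < I], and the midpoint lies
    strictly between them. *)
Lemma threshold_lt (D I r : R) : 0 <= D -> 0 <= r -> r < D * I ->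
  [/\ 0 < D, threshold D I r < ln 2 * I & r * ln 2 < D * threshold D I r].
Proof.
move=> D0 r0 rI.
have ln2 : 0 < ln 2 :> R by rewrite ln_gt0 // ltr1n.
have Dp : 0 < D.
  rewrite lt_neqAle D0 andbT; apply/eqP => D00; move: rI.
  by rewrite -D00 mul0r ltNge r0.
have rD : r / D < I by rewrite ltr_pdivrMr // mulrC.
split => //; first by rewrite /threshold ltr_pM2l //; lra.
rewrite /threshold mulrCA (mulrC r) ltr_pM2l //.
have -> : r = D * (r / D) by rewrite mulrC divfK // gt_eqF.
rewrite ltr_pM2l //.
have -> : D * (r / D) / D = r / D by field; rewrite gt_eqF.
lra.
Qed.

Variables (D : R) (ni : nat -> nat).
Hypothesis D1 : D <= 1.
Hypothesis hni : forall n, D * n%:R <= (ni n)%:R + 1.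

(** The phase length [ni n] falls short of [D * n] by at most one use, lost to rounding; with
    [D <= 1] this gives [(ni n).+1 >= (D / 2) * n.+1]. *)
Lemma cvg_inv_len (c : R) : 0 < D ->
  (fun n => c / (ni n).+1%:R) @ \oo --> (0 : R).
Proof.
move=> D0.
suff h : (fun n => (ni n).+1%:R^-1 : R) @ \oo --> (0 : R).
  by rewrite -(mulr0 c); apply: cvgMr.
apply: (@squeeze_cvgr _ _ _ _ (fun=> 0) (fun n => (2 / D) * harmonic n)).
- apply: nearW => n; rewrite invr_ge0 ler0n /= /harmonic /=.
  rewrite -[2 / D]invf_div -invfM lef_pV2 ?posrE ?mulr_gt0 ?divr_gt0 //.
  have ni0 : 0 <= (ni n)%:R :> R by [].
  have := hni n; rewrite -(natr1 n) -(natr1 (ni n)).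
  move: (n%:R : R) ((ni n)%:R : R) ni0 => a b b0 h.
  have -> : D / 2 * (a + 1) = (D * a + D) / 2 by field.
  move: (D * a) h => e h.
  have g (u v x : R) : u <= 1 -> 0 <= v -> x <= v + 1 -> (x + u) / 2 <= v + 1 by move=> u1 v0 xv; lra.
  exact: g.
- exact: cvg_cst.
- by rewrite -(mulr0 (2 / D)); apply: cvgMr; apply: cvg_harmonic.
Qed.

(** The product is at most [expR th] times a geometric sequence of ratio [z < 1]; the factor
    [expR th] pays for the channel use lost to rounding. *)
Lemma cvg_alarm (r th : R) (M : nat -> R) : 0 < D -> 0 <= th ->
  r * ln 2 < D * th ->
  (forall n, 0 <= M n <= expR (n%:R * (r * ln 2))) ->
  (fun n => M n * expR (- ((ni n)%:R * th))) @ \oo --> (0 : R).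
Proof.
move=> D0 th0 rth hM.
set z := expR (r * ln 2 - D * th).
apply: (@squeeze_cvgr _ _ _ _ (fun=> 0) (fun n => expR th * z ^+ n)).
- apply: nearW => n; have /andP[M0 M1] := hM n.
  rewrite mulr_ge0 ?expR_ge0 //= -expRM_natl -expRD.
  apply: le_trans (ler_wpM2r (expR_ge0 _) M1) _.
  rewrite -expRD ler_expR.
  have := ler_wpM2r th0 (hni n); lra.
- exact: cvg_cst.
- rewrite -(mulr0 (expR th)); apply: cvgMr; apply: cvg_expr.
  by rewrite ger0_norm ?expR_ge0 // expR_lt1 subr_lt0.
Qed.

Lemma cvg_test (I r : R) (M : nat -> R) : 0 <= D -> 0 <= r -> r < D * I ->
  (forall n, 0 <= M n <= expR (n%:R * (r * ln 2))) ->
  (forall c, (fun n => c / (ni n).+1%:R) @ \oo --> (0 : R)) /\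
  (fun n => M n * expR (- ((ni n)%:R * threshold D I r))) @ \oo --> (0 : R).
Proof.
move=> D0 r0 rI hM; have [Dp _ rth] := threshold_lt D0 r0 rI.
split; first by move=> c; apply: cvg_inv_len.
apply: (cvg_alarm Dp _ rth hM).
have : 0 < D * threshold D I r.
  by apply: le_lt_trans rth; rewrite mulr_ge0 // ln_ge0 // ler1n.
by rewrite pmulr_rgt0 // => /ltW.
Qed.

Lemma cvg_len_ratio : 0 <= D -> (forall n, (ni n)%:R <= D * n%:R + 1) ->
  (fun n => (ni n)%:R / n%:R : R) @ \oo --> D.
Proof.
move=> D0 hni'.
have h2 : (fun n => 2 * harmonic n : R) @ \oo --> (0 : R).
  by rewrite -(mulr0 2); apply: cvgMr; apply: cvg_harmonic.
apply: (@squeeze_cvgr _ _ _ _ (fun n => D - 2 * harmonic n) (fun n => D + 2 * harmonic n)).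
(* At [n = 0] the quotient is 0 by convention and lies between the bounds because [0 <= D <= 1];
   otherwise the rounding error [1 / n] is at most [2 * harmonic n]. *)
- apply: nearW => -[|n].
    rewrite /harmonic /= invr1 invr0 mulr0 mulr1 subr_le0 addr_ge0 // andbT.
    by rewrite (le_trans D1) // ler1n.
  have n0 : 0 < n.+1%:R :> R by rewrite ltr0n.
  have hn : n.+1%:R^-1 <= 2 * harmonic n.+1 :> R.
    rewrite /harmonic /= ler_pdivlMr ?ltr0n // ler_pdivrMl //.
    by rewrite -natrM ler_nat muln2 -addnn addSn addnS ltnS ltnS leq_addr.
  apply/andP; split.
    apply: (@le_trans _ _ (D - n.+1%:R^-1)); first by rewrite lerD2l lerN2.
    by rewrite ler_pdivlMr // mulrBl mulVf ?gt_eqF // lerBlDr hni.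
  apply: (@le_trans _ _ (D + n.+1%:R^-1)); last by rewrite lerD2l.
  by rewrite ler_pdivrMr // mulrDl mulVf ?gt_eqF.
- by rewrite -[in X in _ --> X](subr0 D); apply: cvgB => //; apply: cvg_cst.
- by rewrite -[in X in _ --> X](addr0 D); apply: cvgD => //; apply: cvg_cst.
Qed.

Lemma cvg_sum0 (I : Type) (s : seq I) (Q : pred I) (F : I -> nat -> R) :
  (forall i, Q i -> F i n @[n --> \oo] --> (0 : R)) ->
  \sum_(i <- s | Q i) F i n @[n --> \oo] --> (0 : R).
Proof.
move=> hF; elim: s => [|i s IH].
  under eq_fun do rewrite big_nil; exact: cvg_cst.
under eq_fun do rewrite big_cons.
case Qi: (Q i) => //.
by have := cvgD (hF _ Qi) IH; rewrite addr0; exact.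
Qed.

Lemma squeeze0 (f g : nat -> R) : (forall n, 0 <= f n <= g n) ->
  g @ \oo --> (0 : R) -> f @ \oo --> (0 : R).
Proof.
move=> fg; apply: (@squeeze_cvgr _ _ _ _ (fun=> 0)); first exact: nearW.
exact: cvg_cst.
Qed.

Lemma cvgD0 (f g : nat -> R) : f @ \oo --> (0 : R) -> g @ \oo --> (0 : R) ->
  (fun n => f n + g n) @ \oo --> (0 : R).
Proof. by move=> f0 g0; have := cvgD f0 g0; rewrite addr0; exact. Qed.

End Asymptotics.

(** * Random codes for the two-phase protocol *)

Section RandomCoding.
Variables (R : realType) (m : nat) (X Y : 'I_m -> finType)
  (Xa Xb Ya Yb : finType) (A B : {set 'I_m})
  (W1 : Xa -> Xb -> outR Y -> R) (W2 : in2 X A B -> Ya * Yb -> R)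
  (HW1 : forall xa xb, is_pmf (W1 xa xb))
  (HW2 : forall x2, is_pmf (W2 x2))
  (Q : finType)
  (pQ : Q -> R) (pa : Q -> Xa -> R) (pb : Q -> Xb -> R)
  (pAB : Q -> inS X (A :&: B) -> R) (pAo : Q -> inS X (A :\: B) -> R)
  (pBo : Q -> inS X (B :\: A) -> R)
  (hpQ : is_pmf pQ) (hpa : forall q, is_pmf (pa q))
  (hpb : forall q, is_pmf (pb q)) (hpAB : forall q, is_pmf (pAB q))
  (hpAo : forall q, is_pmf (pAo q)) (hpBo : forall q, is_pmf (pBo q)).

Let P := joint_pmf pQ pa pb W1 pAB pAo pBo W2.
Let Qv := @rvQ m X Y Xa Xb Ya Yb A B Q.
Let Xav := @rvXa m X Y Xa Xb Ya Yb A B Q.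
Let Xbv := @rvXb m X Y Xa Xb Ya Yb A B Q.
Let Yrv := @rvYr m X Y Xa Xb Ya Yb A B Q.
Let XAv := @rvXA m X Y Xa Xb Ya Yb A B Q.
Let XBv := @rvXB m X Y Xa Xb Ya Yb A B Q.
Let Yav := @rvYa m X Y Xa Xb Ya Yb A B Q.
Let Ybv := @rvYb m X Y Xa Xb Ya Yb A B Q.
Local Notation Om := (omega X Y Xa Xb Ya Yb A B Q).
Local Notation in2 := (in2 X A B).

(** Regrouped as left-nested pairs, the product law is peeled one kernel at a time by [Ex_pair]. *)
Lemma Ex_joint (f : Om -> R) :
  Ex P f = Ex pQ (fun q => Ex (pa q) (fun xa => Ex (pb q) (fun xb =>
    Ex (W1 xa xb) (fun y => Ex (pAB q) (fun x => Ex (pAo q) (fun x' =>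
    Ex (pBo q) (fun x'' => Ex (W2 (x, x', x'')) (fun y2 =>
      f (q, xa, xb, y, (x, x', x''), y2))))))))).
Proof.
pose law_letter2 q (x : in2) := pAB q x.1.1 * pAo q x.1.2 * pBo q x.2.
pose pin (u : Q * Xa * Xb * outR Y) :=
  pQ u.1.1.1 * pa u.1.1.1 u.1.1.2 * pb u.1.1.1 u.1.2 * W1 u.1.1.2 u.1.2 u.2.
transitivity (Ex (fun w : Om => pin w.1.1 * law_letter2 w.1.1.1.1.1 w.1.2 * W2 w.1.2 w.2) f).
  apply: eq_bigr => -[[[[[q xa] xb] y] [[x x'] x'']] y2] _.
  by rewrite /P /joint_pmf /pin /law_letter2 /= !mulrA.
rewrite (Ex_pair (fun u : Q * Xa * Xb * outR Y * in2 => pin u.1 * law_letter2 u.1.1.1.1 u.2)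
  (fun u => W2 u.2)).
rewrite (Ex_pair pin (fun u => law_letter2 u.1.1.1)) /pin.
rewrite (Ex_pair (fun u : Q * Xa * Xb => pQ u.1.1 * pa u.1.1 u.1.2 * pb u.1.1 u.2)
  (fun u => W1 u.1.2 u.2)).
rewrite (Ex_pair (fun u : Q * Xa => pQ u.1 * pa u.1 u.2) (fun u => pb u.1)).
rewrite (Ex_pair pQ pa).
apply: eq_Ex => q; apply: eq_Ex => xa; apply: eq_Ex => xb; apply: eq_Ex => y /=.
rewrite (Ex_pair (fun x : inS X (A :&: B) * inS X (A :\: B) => pAB q x.1 * pAo q x.2)
  (fun=> pBo q)).
by rewrite (Ex_pair (pAB q) (fun=> pAo q)).
Qed.

Lemma Ex_phase1 (f : Q -> Xa -> Xb -> outR Y -> R) :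
  Ex P (fun w => f (Qv w) (Xav w) (Xbv w) w.1.1.2) =
  Ex pQ (fun q => Ex (pa q) (fun xa => Ex (pb q) (fun xb => Ex (W1 xa xb) (f q xa xb)))).
Proof.
rewrite Ex_joint; do 4!(apply: eq_Ex => ?).
by do 4!(apply: Ex_eq_const => // ?).
Qed.

Lemma Ex_phase2 (f : Q -> in2 -> Ya * Yb -> R) :
  Ex P (fun w => f (Qv w) w.1.2 w.2) =
  Ex pQ (fun q => Ex (pAB q) (fun x => Ex (pAo q) (fun x' => Ex (pBo q) (fun x'' =>
    Ex (W2 (x, x', x'')) (f q (x, x', x'')))))).
Proof.
rewrite Ex_joint; apply: eq_Ex => q.
by do 3!(apply: Ex_eq_const => // ?).
Qed.

Lemma joint_is_pmf : is_pmf P.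
Proof.
split=> [[[[[[q xa] xb] y] [[x x'] x'']] y2]|].
  by rewrite !mulr_ge0 ?hpQ.1 ?(hpa _).1 ?(hpb _).1 ?(HW1 _ _).1 ?(hpAB _).1
    ?(hpAo _).1 ?(hpBo _).1 ?(HW2 _).1.
transitivity (Ex P (fun=> 1)); first by apply: eq_bigr => w _; rewrite mulr1.
rewrite (Ex_phase1 (fun _ _ _ _ => 1)).
by do 4!(apply: Ex_eq_const => // ?).
Qed.

Let hP := joint_is_pmf.

Variables (n1 n2 Ma Mb : nat).

(* A codebook is an i.i.d. sequence whose k-th letter lists the k-th symbols of
   all codewords together with the time-sharing symbol. *)
Definition letter1 : finType := (Q * {ffun 'I_Ma -> Xa} * {ffun 'I_Mb -> Xb})%type.
Definition letter2 : finType := (Q * {ffun 'I_Ma * 'I_Mb -> inS X (A :&: B)} *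
  {ffun 'I_Ma -> inS X (A :\: B)} * {ffun 'I_Mb -> inS X (B :\: A)})%type.

(** The two phases draw their time-sharing symbols separately: each information quantity involves
    the variables of one phase only, so only the law of that phase together with [Q] matters. *)
Definition law_letter1 (s : letter1) : R := pQ s.1.1 * iid (pa s.1.1) s.1.2 * iid (pb s.1.1) s.2.
Definition law_letter2 (s : letter2) : R := pQ s.1.1.1 * iid (pAB s.1.1.1) s.1.1.2 *
  iid (pAo s.1.1.1) s.1.2 * iid (pBo s.1.1.1) s.2.

Lemma p1_pmf : is_pmf law_letter1.
Proof.
apply: (pair_pmf (p := fun u : Q * {ffun 'I_Ma -> Xa} => pQ u.1 * iid (pa u.1) u.2)
  (W := fun u => iid (pb u.1))) => [|u]; last exact: iid_pmf.
by apply: (pair_pmf (W := fun q => iid (pa q)) hpQ) => q; apply: iid_pmf.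
Qed.

Lemma p2_pmf : is_pmf law_letter2.
Proof.
apply: (pair_pmf (p := fun u : Q * {ffun 'I_Ma * 'I_Mb -> inS X (A :&: B)} *
    {ffun 'I_Ma -> inS X (A :\: B)} =>
    pQ u.1.1 * iid (pAB u.1.1) u.1.2 * iid (pAo u.1.1) u.2)
  (W := fun u => iid (pBo u.1.1))) => [|u]; last exact: iid_pmf.
apply: (pair_pmf (p := fun u : Q * {ffun 'I_Ma * 'I_Mb -> inS X (A :&: B)} =>
    pQ u.1 * iid (pAB u.1) u.2)
  (W := fun u => iid (pAo u.1))) => [|u]; last exact: iid_pmf.
by apply: (pair_pmf (W := fun q => iid (pAB q)) hpQ) => q; apply: iid_pmf.
Qed.

Lemma Ex_p1 (f : letter1 -> R) : Ex law_letter1 f =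
  Ex pQ (fun q => Ex (iid (pa q)) (fun ca => Ex (iid (pb q)) (fun cb => f (q, ca, cb)))).
Proof.
rewrite (Ex_pair (fun u : Q * {ffun 'I_Ma -> Xa} => pQ u.1 * iid (pa u.1) u.2)
  (fun u => iid (pb u.1))).
by rewrite (Ex_pair pQ (fun q => iid (pa q))).
Qed.

Lemma Ex_p2 (f : letter2 -> R) : Ex law_letter2 f =
  Ex pQ (fun q => Ex (iid (pAB q)) (fun c => Ex (iid (pAo q)) (fun c' =>
    Ex (iid (pBo q)) (fun c'' => f (q, c, c', c''))))).
Proof.
rewrite (Ex_pair (fun u : Q * {ffun 'I_Ma * 'I_Mb -> inS X (A :&: B)} *
    {ffun 'I_Ma -> inS X (A :\: B)} =>
    pQ u.1.1 * iid (pAB u.1.1) u.1.2 * iid (pAo u.1.1) u.2)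
  (fun u => iid (pBo u.1.1))).
rewrite (Ex_pair (fun u : Q * {ffun 'I_Ma * 'I_Mb -> inS X (A :&: B)} =>
    pQ u.1 * iid (pAB u.1) u.2) (fun u => iid (pAo u.1))).
by rewrite (Ex_pair pQ (fun q => iid (pAB q))).
Qed.

(** For fixed messages a whole codebook letter serves as channel input, so codebook and output
    together form an i.i.d. sequence. *)
Definition chan1 wa wb (s : letter1) : outR Y -> R := W1 (s.1.2 wa) (s.2 wb).
Definition relay_input wa wb (s : letter2) : in2 := (s.1.1.2 (wa, wb), s.1.2 wa, s.2 wb).
Definition chan2 wa wb (s : letter2) : Ya * Yb -> R := W2 (relay_input wa wb s).

(** * Single-letter laws of the true and the wrong codewords *)

Section Single.
Variables (wa wa' : 'I_Ma) (wb wb' : 'I_Mb).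

Lemma Ex_true1 (f : Q -> Xa -> Xb -> outR Y -> R) :
  Ex law_letter1 (fun s => Ex (chan1 wa wb s) (fun y => f s.1.1 (s.1.2 wa) (s.2 wb) y)) =
  Ex P (fun w => f (Qv w) (Xav w) (Xbv w) w.1.1.2).
Proof.
rewrite Ex_p1 Ex_phase1; apply: eq_Ex => q /=.
under eq_Ex => ca do
  rewrite (Ex_iid1 (hpb q) wb (fun xb => Ex (W1 (ca wa) xb) (f q (ca wa) xb))).
by rewrite (Ex_iid1 (hpa q) wa (fun xa => Ex (pb q) (fun xb => Ex (W1 xa xb) (f q xa xb)))).
Qed.

(** Symbols of distinct messages are independent given [q], so the symbol of [wa'] is a fresh draw
    unrelated to the output; exchanging sums moves it innermost. *)
Lemma Ex_wrong_a (f : Q -> Xa -> Xb -> outR Y -> R) : wa' != wa ->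
  Ex law_letter1 (fun s => Ex (chan1 wa wb s) (fun y => f s.1.1 (s.1.2 wa') (s.2 wb) y)) =
  Ex P (fun w => Ex (pa (Qv w)) (fun xa => f (Qv w) xa (Xbv w) w.1.1.2)).
Proof.
move=> ne; rewrite Ex_p1 (Ex_phase1 (fun q _ xb y => Ex (pa q) (fun xa => f q xa xb y))).
apply: eq_Ex => q /=.
under eq_Ex => ca do
  rewrite (Ex_iid1 (hpb q) wb (fun xb => Ex (W1 (ca wa) xb) (f q (ca wa') xb))).
rewrite (Ex_iid2 (hpa q) (fun xa' xa => Ex (pb q) (fun xb => Ex (W1 xa xb) (f q xa' xb)))) //.
rewrite Ex_exch; apply: eq_Ex => xa; rewrite Ex_exch; apply: eq_Ex => xb.
by rewrite Ex_exch.
Qed.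

Lemma Ex_wrong_b (f : Q -> Xa -> Xb -> outR Y -> R) : wb' != wb ->
  Ex law_letter1 (fun s => Ex (chan1 wa wb s) (fun y => f s.1.1 (s.1.2 wa) (s.2 wb') y)) =
  Ex P (fun w => Ex (pb (Qv w)) (fun xb => f (Qv w) (Xav w) xb w.1.1.2)).
Proof.
move=> ne; rewrite Ex_p1 (Ex_phase1 (fun q xa _ y => Ex (pb q) (fun xb => f q xa xb y))).
apply: eq_Ex => q /=.
under eq_Ex => ca do rewrite (Ex_iid2 (hpb q)
  (fun xb' xb => Ex (W1 (ca wa) xb) (f q (ca wa) xb'))) //.
rewrite (Ex_iid1 (hpa q) wa
  (fun xa => Ex (pb q) (fun xb' => Ex (pb q) (fun xb => Ex (W1 xa xb) (f q xa xb'))))).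
apply: eq_Ex => xa; rewrite Ex_exch; apply: eq_Ex => xb.
by rewrite Ex_exch.
Qed.

Lemma Ex_wrong_ab (f : Q -> Xa -> Xb -> outR Y -> R) : wa' != wa -> wb' != wb ->
  Ex law_letter1 (fun s => Ex (chan1 wa wb s) (fun y => f s.1.1 (s.1.2 wa') (s.2 wb') y)) =
  Ex P (fun w => Ex (fun x => pa (Qv w) x.1 * pb (Qv w) x.2)
    (fun x => f (Qv w) x.1 x.2 w.1.1.2)).
Proof.
move=> nea neb; rewrite Ex_p1 (Ex_phase1 (fun q _ _ y =>
  Ex (fun x => pa q x.1 * pb q x.2) (fun x => f q x.1 x.2 y))).
apply: eq_Ex => q /=.
under eq_Ex => ca do rewrite (Ex_iid2 (hpb q)
  (fun xb' xb => Ex (W1 (ca wa) xb) (f q (ca wa') xb'))) //.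
rewrite (Ex_iid2 (hpa q) (fun xa' xa => Ex (pb q) (fun xb' => Ex (pb q) (fun xb =>
  Ex (W1 xa xb) (f q xa' xb'))))) //.
rewrite Ex_exch; apply: eq_Ex => xa.
under eq_Ex do rewrite Ex_exch.
rewrite Ex_exch; apply: eq_Ex => xb.
under eq_Ex do rewrite Ex_exch.
rewrite Ex_exch; apply: eq_Ex => y.
by rewrite (Ex_pair (pa q) (fun=> pb q)).
Qed.

Lemma Ex_true2 (f : Q -> in2 -> Ya * Yb -> R) :
  Ex law_letter2 (fun s => Ex (chan2 wa wb s) (fun y => f s.1.1.1 (relay_input wa wb s) y)) =
  Ex P (fun w => f (Qv w) w.1.2 w.2).
Proof.
rewrite Ex_p2 Ex_phase2; apply: eq_Ex => q; rewrite /chan2 /relay_input /=.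
under eq_Ex => c do under eq_Ex => c' do
  rewrite (Ex_iid1 (hpBo q) wb (fun x'' => Ex (W2 (c (wa, wb), c' wa, x''))
     (f q (c (wa, wb), c' wa, x'')))).
under eq_Ex => c do rewrite (Ex_iid1 (hpAo q) wa
  (fun x' => Ex (pBo q) (fun x'' => Ex (W2 (c (wa, wb), x', x''))
     (f q (c (wa, wb), x', x''))))).
by rewrite (Ex_iid1 (hpAB q) (wa, wb) (fun x => Ex (pAo q) (fun x' => Ex (pBo q)
  (fun x'' => Ex (W2 (x, x', x'')) (f q (x, x', x'')))))).
Qed.

(** As [wa'] differs from [wa], so does the index pair [(wa', wb)] from [(wa, wb)]: both blocks of
    the wrong candidate are fresh draws. *)
Lemma Ex_wrong_A (f : Q -> inS X (A :&: B) * inS X (A :\: B) -> Ya * Yb -> R) :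
  wa' != wa ->
  Ex law_letter2 (fun s => Ex (chan2 wa wb s)
    (fun y => f s.1.1.1 (s.1.1.2 (wa', wb), s.1.2 wa') y)) =
  Ex P (fun w => Ex (fun x => pAB (Qv w) x.1 * pAo (Qv w) x.2)
    (fun x => f (Qv w) x w.2)).
Proof.
move=> ne; rewrite Ex_p2 (Ex_phase2 (fun q _ y =>
  Ex (fun x => pAB q x.1 * pAo q x.2) (fun x => f q x y))).
apply: eq_Ex => q; rewrite /chan2 /relay_input /=.
under eq_Ex => c do under eq_Ex => c' do
  rewrite (Ex_iid1 (hpBo q) wb (fun x'' => Ex (W2 (c (wa, wb), c' wa, x''))
     (f q (c (wa', wb), c' wa')))).
under eq_Ex => c do rewrite (Ex_iid2 (hpAo q)
  (fun u' x' => Ex (pBo q) (fun x'' => Ex (W2 (c (wa, wb), x', x''))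
     (f q (c (wa', wb), u'))))) //.
rewrite (Ex_iid2 (hpAB q) (fun u x => Ex (pAo q) (fun u' => Ex (pAo q) (fun x' => Ex (pBo q)
  (fun x'' => Ex (W2 (x, x', x'')) (f q (u, u'))))))) ?xpair_eqE ?negb_and ?ne //.
rewrite Ex_exch; apply: eq_Ex => x.
under eq_Ex do rewrite Ex_exch.
rewrite Ex_exch; apply: eq_Ex => x'.
under eq_Ex do rewrite Ex_exch.
rewrite Ex_exch; apply: eq_Ex => x''.
under eq_Ex do rewrite Ex_exch.
rewrite Ex_exch; apply: eq_Ex => y.
by rewrite (Ex_pair (pAB q) (fun=> pAo q)).
Qed.

Lemma Ex_wrong_B (f : Q -> inS X (A :&: B) * inS X (B :\: A) -> Ya * Yb -> R) :
  wb' != wb ->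
  Ex law_letter2 (fun s => Ex (chan2 wa wb s)
    (fun y => f s.1.1.1 (s.1.1.2 (wa, wb'), s.2 wb') y)) =
  Ex P (fun w => Ex (fun x => pAB (Qv w) x.1 * pBo (Qv w) x.2)
    (fun x => f (Qv w) x w.2)).
Proof.
move=> ne; rewrite Ex_p2 (Ex_phase2 (fun q _ y =>
  Ex (fun x => pAB q x.1 * pBo q x.2) (fun x => f q x y))).
apply: eq_Ex => q; rewrite /chan2 /relay_input /=.
under eq_Ex => c do under eq_Ex => c' do
  rewrite (Ex_iid2 (hpBo q) (fun u'' x'' => Ex (W2 (c (wa, wb), c' wa, x''))
     (f q (c (wa, wb'), u'')))) //.
under eq_Ex => c do rewrite (Ex_iid1 (hpAo q) wa
  (fun x' => Ex (pBo q) (fun u'' => Ex (pBo q) (fun x'' => Ex (W2 (c (wa, wb), x', x''))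
     (f q (c (wa, wb'), u'')))))).
rewrite (Ex_iid2 (hpAB q) (fun u x => Ex (pAo q) (fun x' => Ex (pBo q) (fun u'' => Ex (pBo q)
  (fun x'' => Ex (W2 (x, x', x'')) (f q (u, u''))))))) ?xpair_eqE ?negb_and ?ne ?orbT //.
rewrite Ex_exch; apply: eq_Ex => x.
rewrite Ex_exch; apply: eq_Ex => x'.
under eq_Ex do rewrite Ex_exch.
rewrite Ex_exch; apply: eq_Ex => x''.
under eq_Ex do rewrite Ex_exch.
rewrite Ex_exch; apply: eq_Ex => y.
by rewrite (Ex_pair (pAB q) (fun=> pBo q)).
Qed.

End Single.

(** * Output laws and conditional laws of the inputs *)

Lemma kV1_pmf wa wb w : is_pmf (@kprod R 'I_n1 _ _ (chan1 wa wb) w).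
Proof. by apply: kprod_pmf => s; apply: HW1. Qed.

Lemma kV2_pmf wa wb w : is_pmf (@kprod R 'I_n2 _ _ (chan2 wa wb) w).
Proof. by apply: kprod_pmf => s; apply: HW2. Qed.

(** Independence of the terminal inputs given [Q] makes [pa] the conditional law of [Xav] given
    [(Xbv, Qv)], as [false_alarm_le] requires. *)
Lemma indep_a (h : Xa -> Xb * Q -> R) :
  Ex P (fun w => h (Xav w) (Xbv w, Qv w)) =
  Ex P (fun w => Ex (pa (Qv w)) (fun v => h v (Xbv w, Qv w))).
Proof.
rewrite (Ex_phase1 (fun q xa xb _ => h xa (xb, q))).
rewrite (Ex_phase1 (fun q _ xb _ => Ex (pa q) (fun xa => h xa (xb, q)))).
apply: eq_Ex => q; apply/esym/Ex_eq_const => // xa; rewrite [RHS]Ex_exch.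
apply: eq_Ex => xb; apply: Ex_eq_const => // y.
by apply: eq_Ex => xa'; rewrite Ex_const.
Qed.

Lemma indep_b (h : Xb -> Xa * Q -> R) :
  Ex P (fun w => h (Xbv w) (Xav w, Qv w)) =
  Ex P (fun w => Ex (pb (Qv w)) (fun v => h v (Xav w, Qv w))).
Proof.
rewrite (Ex_phase1 (fun q xa xb _ => h xb (xa, q))).
rewrite (Ex_phase1 (fun q xa _ _ => Ex (pb q) (fun xb => h xb (xa, q)))).
apply: eq_Ex => q; apply: eq_Ex => xa; apply/esym.
do 2!(apply: Ex_eq_const => // ?).
by apply: eq_Ex => xb; rewrite Ex_const.
Qed.

Lemma indep_ab (h : Xa * Xb -> Q -> R) :
  Ex P (fun w => h (Xav w, Xbv w) (Qv w)) =
  Ex P (fun w => Ex (fun x => pa (Qv w) x.1 * pb (Qv w) x.2) (fun v => h v (Qv w))).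
Proof.
rewrite (Ex_phase1 (fun q xa xb _ => h (xa, xb) q)).
rewrite (Ex_phase1 (fun q _ _ _ => Ex (fun x => pa q x.1 * pb q x.2) (fun v => h v q))).
apply: eq_Ex => q; apply/esym; do 3!(apply: Ex_eq_const => // ?).
rewrite (Ex_pair (pa q) (fun=> pb q)); apply: eq_Ex => xa; apply: eq_Ex => xb.
by rewrite Ex_const.
Qed.

Lemma indep_aQ (h : Xa -> Q -> R) :
  Ex P (fun w => h (Xav w) (Qv w)) =
  Ex P (fun w => Ex (pa (Qv w)) (fun v => h v (Qv w))).
Proof. exact: (indep_a (fun v c => h v c.2)). Qed.

Lemma indep_bQ (h : Xb -> Q -> R) :
  Ex P (fun w => h (Xbv w) (Qv w)) =
  Ex P (fun w => Ex (pb (Qv w)) (fun v => h v (Qv w))).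
Proof. exact: (indep_b (fun v c => h v c.2)). Qed.

Lemma indep_A (h : inS X (A :&: B) * inS X (A :\: B) -> Q -> R) :
  Ex P (fun w => h (XAv w) (Qv w)) =
  Ex P (fun w => Ex (fun x => pAB (Qv w) x.1 * pAo (Qv w) x.2) (fun v => h v (Qv w))).
Proof.
rewrite (Ex_phase2 (fun q x _ => h (x.1.1, x.1.2) q)).
rewrite (Ex_phase2 (fun q _ _ => Ex (fun x => pAB q x.1 * pAo q x.2) (fun v => h v q))).
apply: eq_Ex => q; apply/esym; do 4!(apply: Ex_eq_const => // ?).
rewrite (Ex_pair (pAB q) (fun=> pAo q)); apply: eq_Ex => x; apply: eq_Ex => x'.
by apply/esym; do 2!(apply: Ex_eq_const => // ?).
Qed.

Lemma indep_B (h : inS X (A :&: B) * inS X (B :\: A) -> Q -> R) :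
  Ex P (fun w => h (XBv w) (Qv w)) =
  Ex P (fun w => Ex (fun x => pAB (Qv w) x.1 * pBo (Qv w) x.2) (fun v => h v (Qv w))).
Proof.
rewrite (Ex_phase2 (fun q x _ => h (x.1.1, x.2) q)).
rewrite (Ex_phase2 (fun q _ _ => Ex (fun x => pAB q x.1 * pBo q x.2) (fun v => h v q))).
apply: eq_Ex => q; apply/esym; do 4!(apply: Ex_eq_const => // ?).
rewrite (Ex_pair (pAB q) (fun=> pBo q)); apply: eq_Ex => x.
apply/esym; apply: Ex_eq_const => // x'; apply: eq_Ex => x''.
by rewrite Ex_const.
Qed.

(** * Decoders and the random code *)

Variables (ta tb tab ua ub : 'I_m -> R) (sa sb : R) (a0 : 'I_Ma) (b0 : 'I_Mb).

Section Decoders.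
Variables (r : 'I_m) (w : {ffun 'I_n1 -> letter1}) (y : 'I_n1 -> Y r).

Definition passa wa wb := test P Xav (Yrv r) (fun u => (Xbv u, Qv u)) (ta r)
  (fun k => (w k).1.2 wa) y (fun k => ((w k).2 wb, (w k).1.1)).
Definition passb wa wb := test P Xbv (Yrv r) (fun u => (Xav u, Qv u)) (tb r)
  (fun k => (w k).2 wb) y (fun k => ((w k).1.2 wa, (w k).1.1)).
Definition passab wa wb := test P (fun u => (Xav u, Xbv u)) (Yrv r) Qv (tab r)
  (fun k => ((w k).1.2 wa, (w k).2 wb)) y (fun k => (w k).1.1).

Definition decAB : 'I_Ma * 'I_Mb := decode_by (a0, b0)
  (fun u => [&& passa u.1 u.2, passb u.1 u.2 & passab u.1 u.2]).
Definition decA : 'I_Ma := decode_by a0 (fun wa =>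
  test P Xav (Yrv r) Qv (ua r) (fun k => (w k).1.2 wa) y (fun k => (w k).1.1)).
Definition decB : 'I_Mb := decode_by b0 (fun wb =>
  test P Xbv (Yrv r) Qv (ub r) (fun k => (w k).2 wb) y (fun k => (w k).1.1)).
End Decoders.

(** Terminal [b] knows [wb], so all candidates share it. *)
Definition decb (w : {ffun 'I_n2 -> letter2}) (wb : 'I_Mb) (y : 'I_n2 -> Yb) : 'I_Ma :=
  decode_by a0 (fun wa => test P XAv Ybv Qv sa
    (fun k => ((w k).1.1.2 (wa, wb), (w k).1.2 wa)) y (fun k => (w k).1.1.1)).
Definition deca (w : {ffun 'I_n2 -> letter2}) (wa : 'I_Ma) (y : 'I_n2 -> Ya) : 'I_Mb :=
  decode_by b0 (fun wb => test P XBv Yav Qv sb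
    (fun k => ((w k).1.1.2 (wa, wb), (w k).2 wb)) y (fun k => (w k).1.1.1)).

Definition code (w1 : {ffun 'I_n1 -> letter1}) (w2 : {ffun 'I_n2 -> letter2}) : mabc_code X Y Xa Xb Ya Yb A B n1 n2 Ma Mb :=
  {| enc_a := fun wa => [ffun k => (w1 k).1.2 wa];
     enc_b := fun wb => [ffun k => (w1 k).2 wb];
     rel_AB := fun s y => [ffun k => (w2 k).1.1.2 (decAB w1 (y : 'I_n1 -> Y (val s))) s];
     rel_A := fun s y => [ffun k => (w2 k).1.2 (decA w1 (y : 'I_n1 -> Y (val s))) s];
     rel_B := fun s y => [ffun k => (w2 k).2 (decB w1 (y : 'I_n1 -> Y (val s))) s];
     dec_a := fun wa y => deca w2 wa y;
     dec_b := fun wb y => decb w2 wb y |}.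

(** A count of failing relays: at least 1 once a relay fails, and linear under expectation. *)
Definition relay_err w1 wa wb (y : {ffun 'I_n1 -> outR Y}) : R :=
  \sum_(r in A :&: B) (decAB w1 (fun k => y k r) != (wa, wb))%:R +
  \sum_(r in A :\: B) (decA w1 (fun k => y k r) != wa)%:R +
  \sum_(r in B :\: A) (decB w1 (fun k => y k r) != wb)%:R.

(** This decouples the phases. If every relay decodes correctly, phase 2 carries the intended
    [relay_input]; otherwise the relay count alone dominates the error probability. *)
Lemma code_err_le w1 w2 wa wb (bad : {ffun 'I_n2 -> Ya * Yb} -> bool) :
  \sum_(y1 : {ffun 'I_n1 -> outR Y}) \sum_(y2 : {ffun 'I_n2 -> Ya * Yb})
    (\prod_(k : 'I_n1) W1 (enc_a (code w1 w2) wa k) (enc_b (code w1 w2) wb k) (y1 k)) *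
    (\prod_(k : 'I_n2) W2 (x2_of (code w1 w2) y1 k) (y2 k)) * (bad y2)%:R <=
  Ex (kprod (chan1 wa wb) w1) (relay_err w1 wa wb) +
  Ex (kprod (chan2 wa wb) w2) (fun y2 => (bad y2)%:R).
Proof.
set eb := Ex (kprod (chan2 wa wb) w2) _.
have eb0 : 0 <= eb by apply: Ex_ge0; [exact: kV2_pmf|move=> y; exact: ler0n].
rewrite -(Ex_const (kV1_pmf wa wb w1) eb) -ExD /Ex.
apply: ler_sum => y1 _.
have -> : \prod_(k < n1) W1 (enc_a (code w1 w2) wa k) (enc_b (code w1 w2) wb k) (y1 k)
    = kprod (chan1 wa wb) w1 y1.
  by apply: eq_bigr => k _; rewrite /= !ffunE.
under eq_bigr do rewrite -mulrA.
rewrite -mulr_sumr ler_wpM2l ?(kV1_pmf _ _ _).1 //.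
have relE r : relay_obs y1 r = (fun k => y1 k r) :> ('I_n1 -> Y r).
  by apply/funext => k; rewrite ffunE.
have s0 (T : finType) (D : {set T}) (F : T -> bool) : 0 <= \sum_(r in D) (F r)%:R :> R.
  by apply: sumr_ge0.
have s1 (T : finType) (D : {set T}) (F : T -> bool) r :
    r \in D -> F r -> 1 <= \sum_(r in D) (F r)%:R :> R.
  by move=> rD Fr; rewrite (bigD1 r) //= Fr lerDl sumr_ge0.
have [ok|] := boolP [&& [forall r in A :&: B, decAB w1 (fun k => y1 k r) == (wa, wb)],
    [forall r in A :\: B, decA w1 (fun k => y1 k r) == wa] &
    [forall r in B :\: A, decB w1 (fun k => y1 k r) == wb]].
  have x2E k : x2_of (code w1 w2) y1 k = relay_input wa wb (w2 k).
    case/and3P: ok => /forall_inP okAB /forall_inP okA /forall_inP okB.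
    rewrite /x2_of /relay_input; congr (_, _, _); apply/ffunP => s; rewrite !ffunE /= relE.
    - by rewrite (eqP (okAB _ (valP s))).
    - by rewrite (eqP (okA _ (valP s))).
    - by rewrite (eqP (okB _ (valP s))).
  rewrite -[leLHS]add0r lerD //.
    by rewrite /relay_err !addr_ge0.
  by apply: ler_sum => y2 _; under eq_bigr do rewrite x2E.
(* Whatever the relays send, the phase-2 outputs follow a probability law, so the left side is at
   most 1, and one failing relay makes [relay_err] at least 1. *)
move=> nok; apply: (@le_trans _ _ 1).
  rewrite -[leRHS](kprod_pmf [ffun k => x2_of (code w1 w2) y1 k] HW2).2.
  apply: ler_sum => y2 _; rewrite /kprod; under [leRHS]eq_bigr do rewrite ffunE.
  by rewrite ler_piMr ?lern1 ?leq_b1 // prodr_ge0 // => k _; apply: (HW2 _).1.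
rewrite ler_wpDr // /relay_err.
move: nok; rewrite !negb_and => /or3P[] /forall_inPn[r rD nr].
- by rewrite -addrA ler_wpDr ?addr_ge0 // (s1 _ _ _ r).
- by rewrite addrAC ler_wpDl ?addr_ge0 // (s1 _ _ _ r).
- by rewrite ler_wpDl ?addr_ge0 // (s1 _ _ _ r).
Qed.

(** * Error bounds averaged over the codebooks *)

Definition boundAB r : R :=
  miss_bound P Xav (Yrv r) (fun u => (Xbv u, Qv u)) n1 (ta r) +
  miss_bound P Xbv (Yrv r) (fun u => (Xav u, Qv u)) n1 (tb r) +
  miss_bound P (fun u => (Xav u, Xbv u)) (Yrv r) Qv n1 (tab r) +
  Ma%:R * expR (- (n1%:R * ta r)) + Mb%:R * expR (- (n1%:R * tb r)) +
  (Ma%:R * Mb%:R) * expR (- (n1%:R * tab r)).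
Definition boundA r : R :=
  miss_bound P Xav (Yrv r) Qv n1 (ua r) + Ma%:R * expR (- (n1%:R * ua r)).
Definition boundB r : R :=
  miss_bound P Xbv (Yrv r) Qv n1 (ub r) + Mb%:R * expR (- (n1%:R * ub r)).
Definition bound_b : R :=
  miss_bound P XAv Ybv Qv n2 sa + Ma%:R * expR (- (n2%:R * sa)).
Definition bound_a : R :=
  miss_bound P XBv Yav Qv n2 sb + Mb%:R * expR (- (n2%:R * sb)).
Definition bound_relays : R :=
  \sum_(r in A :&: B) boundAB r + \sum_(r in A :\: B) boundA r +
  \sum_(r in B :\: A) boundB r.

(** The misses are controlled by the true law of a letter, the false alarms by the laws with the
    symbol of [wa], of [wb] or both redrawn, for at most [Ma], [Mb] or [Ma * Mb] competitors. *)
Lemma relayAB_le r wa wb :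
  ta r < ln 2 * cmi P Xav (Yrv r) (fun u => (Xbv u, Qv u)) ->
  tb r < ln 2 * cmi P Xbv (Yrv r) (fun u => (Xav u, Qv u)) ->
  tab r < ln 2 * cmi P (fun u => (Xav u, Xbv u)) (Yrv r) Qv ->
  Ex (iid law_letter1) (fun w1 => Ex (kprod (chan1 wa wb) w1) (fun y =>
    (decAB w1 (fun k => y k r) != (wa, wb))%:R)) <= boundAB r.
Proof.
move=> hta htb htab.
apply: le_trans (le_Ex2 (iid_pmf _ p1_pmf) (kV1_pmf wa wb)
  (fun w1 y => decode_by2_err R _ _ _ _ _ _ _)) _.
rewrite !Ex2D !Ex2_sum.
have HV s : is_pmf (chan1 wa wb s) by apply: HW1.
apply: lerD; [apply: lerD; [apply: lerD; [apply: lerD; [apply: lerD|]|]|]|].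
- apply: (miss_le hP n1 p1_pmf HV (v := fun s _ => s.1.2 wa) (y := fun _ t => t r)
    (c := fun s _ => (s.2 wb, s.1.1)) hta) => h.
  exact: (Ex_true1 wa wb (fun q xa xb y => h xa (y r) (xb, q))).
- apply: (miss_le hP n1 p1_pmf HV (v := fun s _ => s.2 wb) (y := fun _ t => t r)
    (c := fun s _ => (s.1.2 wa, s.1.1)) htb) => h.
  exact: (Ex_true1 wa wb (fun q xa xb y => h xb (y r) (xa, q))).
- apply: (miss_le hP n1 p1_pmf HV (v := fun s _ => (s.1.2 wa, s.2 wb))
    (y := fun _ t => t r) (c := fun s _ => s.1.1) htab) => h.
  exact: (Ex_true1 wa wb (fun q xa xb y => h (xa, xb) (y r) q)).
- apply: sum_le_card => [|wa' ne]; first exact: expR_ge0.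
  apply: (false_alarm_le (k := fun c => pa c.2) hP indep_a n1 (ta r) p1_pmf HV (v := fun s _ => s.1.2 wa')
    (y := fun _ t => t r) (c := fun s _ => (s.2 wb, s.1.1))) => h.
  exact: (Ex_wrong_a wb (fun q xa xb y => h xa (y r) (xb, q))).
- apply: sum_le_card => [|wb' ne]; first exact: expR_ge0.
  apply: (false_alarm_le (k := fun c => pb c.2) hP indep_b n1 (tb r) p1_pmf HV (v := fun s _ => s.2 wb')
    (y := fun _ t => t r) (c := fun s _ => (s.1.2 wa, s.1.1))) => h.
  exact: (Ex_wrong_b wa (fun q xa xb y => h xb (y r) (xa, q))).
- rewrite -mulrA; apply: sum_le_card => [|wa' nea].
    by rewrite mulr_ge0 ?expR_ge0.
  rewrite Ex2_sum; apply: sum_le_card => [|wb' neb]; first exact: expR_ge0.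
  apply: (false_alarm_le (k := fun q x => pa q x.1 * pb q x.2) hP indep_ab n1 (tab r) p1_pmf HV
    (v := fun s _ => (s.1.2 wa', s.2 wb'))
    (y := fun _ t => t r) (c := fun s _ => s.1.1)) => h.
  rewrite (Ex_wrong_ab (fun q xa xb y => h (xa, xb) (y r) q) nea neb).
  by apply: eq_Ex => w; apply: eq_Ex => -[].
Qed.

(** The test leaves out the codeword of [wb], which acts as noise; hence the information is
    conditioned on [Qv] alone. *)
Lemma relayA_le r wa wb : ua r < ln 2 * cmi P Xav (Yrv r) Qv ->
  Ex (iid law_letter1) (fun w1 => Ex (kprod (chan1 wa wb) w1) (fun y =>
    (decA w1 (fun k => y k r) != wa)%:R)) <= boundA r.
Proof.
move=> hua.
apply: le_trans (le_Ex2 (iid_pmf _ p1_pmf) (kV1_pmf wa wb)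
  (fun w1 y => decode_by_err _ _ _ _)) _.
rewrite !Ex2D !Ex2_sum.
have HV s : is_pmf (chan1 wa wb s) by apply: HW1.
apply: lerD.
- apply: (miss_le hP n1 p1_pmf HV (v := fun s _ => s.1.2 wa) (y := fun _ t => t r)
    (c := fun s _ => s.1.1) hua) => h.
  exact: (Ex_true1 wa wb (fun q xa xb y => h xa (y r) q)).
- apply: sum_le_card => [|wa' ne]; first exact: expR_ge0.
  apply: (false_alarm_le (k := fun c => pa c) hP indep_aQ n1 (ua r) p1_pmf HV (v := fun s _ => s.1.2 wa')
    (y := fun _ t => t r) (c := fun s _ => s.1.1)) => h.
  exact: (Ex_wrong_a wb (fun q xa xb y => h xa (y r) q)).
Qed.

Lemma relayB_le r wa wb : ub r < ln 2 * cmi P Xbv (Yrv r) Qv ->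
  Ex (iid law_letter1) (fun w1 => Ex (kprod (chan1 wa wb) w1) (fun y =>
    (decB w1 (fun k => y k r) != wb)%:R)) <= boundB r.
Proof.
move=> hub.
apply: le_trans (le_Ex2 (iid_pmf _ p1_pmf) (kV1_pmf wa wb)
  (fun w1 y => decode_by_err _ _ _ _)) _.
rewrite !Ex2D !Ex2_sum.
have HV s : is_pmf (chan1 wa wb s) by apply: HW1.
apply: lerD.
- apply: (miss_le hP n1 p1_pmf HV (v := fun s _ => s.2 wb) (y := fun _ t => t r)
    (c := fun s _ => s.1.1) hub) => h.
  exact: (Ex_true1 wa wb (fun q xa xb y => h xb (y r) q)).
- apply: sum_le_card => [|wb' ne]; first exact: expR_ge0.
  apply: (false_alarm_le (k := fun c => pb c) hP indep_bQ n1 (ub r) p1_pmf HV (v := fun s _ => s.2 wb')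
    (y := fun _ t => t r) (c := fun s _ => s.1.1)) => h.
  exact: (Ex_wrong_b wa (fun q xa xb y => h xb (y r) q)).
Qed.

Lemma terminal_b_le wa wb : sa < ln 2 * cmi P XAv Ybv Qv ->
  Ex (iid law_letter2) (fun w2 => Ex (kprod (chan2 wa wb) w2) (fun y =>
    (decb w2 wb (fun k => (y k).2) != wa)%:R)) <= bound_b.
Proof.
move=> hsa.
apply: le_trans (le_Ex2 (iid_pmf _ p2_pmf) (kV2_pmf wa wb)
  (fun w1 y => decode_by_err _ _ _ _)) _.
rewrite !Ex2D !Ex2_sum.
have HV s : is_pmf (chan2 wa wb s) by apply: HW2.
apply: lerD.
- apply: (miss_le hP n2 p2_pmf HV (v := fun s _ => (s.1.1.2 (wa, wb), s.1.2 wa))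
    (y := fun _ t => t.2) (c := fun s _ => s.1.1.1) hsa) => h.
  exact: (Ex_true2 wa wb (fun q x y => h (x.1.1, x.1.2) y.2 q)).
- apply: sum_le_card => [|wa' ne]; first exact: expR_ge0.
  apply: (false_alarm_le (k := fun q x => pAB q x.1 * pAo q x.2) hP indep_A n2 sa p2_pmf HV
    (v := fun s _ => (s.1.1.2 (wa', wb), s.1.2 wa'))
    (y := fun _ t => t.2) (c := fun s _ => s.1.1.1)) => h.
  exact: (Ex_wrong_A wb (fun q x y => h x y.2 q)).
Qed.

Lemma terminal_a_le wa wb : sb < ln 2 * cmi P XBv Yav Qv ->
  Ex (iid law_letter2) (fun w2 => Ex (kprod (chan2 wa wb) w2) (fun y =>
    (deca w2 wa (fun k => (y k).1) != wb)%:R)) <= bound_a.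
Proof.
move=> hsb.
apply: le_trans (le_Ex2 (iid_pmf _ p2_pmf) (kV2_pmf wa wb)
  (fun w1 y => decode_by_err _ _ _ _)) _.
rewrite !Ex2D !Ex2_sum.
have HV s : is_pmf (chan2 wa wb s) by apply: HW2.
apply: lerD.
- apply: (miss_le hP n2 p2_pmf HV (v := fun s _ => (s.1.1.2 (wa, wb), s.2 wb))
    (y := fun _ t => t.1) (c := fun s _ => s.1.1.1) hsb) => h.
  exact: (Ex_true2 wa wb (fun q x y => h (x.1.1, x.2) y.1 q)).
- apply: sum_le_card => [|wb' ne]; first exact: expR_ge0.
  apply: (false_alarm_le (k := fun q x => pAB q x.1 * pBo q x.2) hP indep_B n2 sb p2_pmf HV
    (v := fun s _ => (s.1.1.2 (wa, wb'), s.2 wb'))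
    (y := fun _ t => t.1) (c := fun s _ => s.1.1.1)) => h.
  exact: (Ex_wrong_B wa (fun q x y => h x y.1 q)).
Qed.

Hypothesis hta : forall r, r \in A :&: B ->
  ta r < ln 2 * cmi P Xav (Yrv r) (fun u => (Xbv u, Qv u)).
Hypothesis htb : forall r, r \in A :&: B ->
  tb r < ln 2 * cmi P Xbv (Yrv r) (fun u => (Xav u, Qv u)).
Hypothesis htab : forall r, r \in A :&: B ->
  tab r < ln 2 * cmi P (fun u => (Xav u, Xbv u)) (Yrv r) Qv.
Hypothesis hua : forall r, r \in A :\: B -> ua r < ln 2 * cmi P Xav (Yrv r) Qv.
Hypothesis hub : forall r, r \in B :\: A -> ub r < ln 2 * cmi P Xbv (Yrv r) Qv.
Hypothesis hsa : sa < ln 2 * cmi P XAv Ybv Qv.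
Hypothesis hsb : sb < ln 2 * cmi P XBv Yav Qv.

Lemma relay_err_le wa wb :
  Ex (iid law_letter1) (fun w1 => Ex (kprod (chan1 wa wb) w1) (relay_err w1 wa wb)) <= bound_relays.
Proof.
rewrite /relay_err !Ex2D !Ex2_sum.
apply: lerD; first apply: lerD; apply: ler_sum => r rD.
- exact: relayAB_le (hta rD) (htb rD) (htab rD).
- exact: relayA_le (hua rD).
- exact: relayB_le (hub rD).
Qed.

(** The bound holds for every message pair, so it passes to the average over messages once that
    average is exchanged with the expectation over codebooks. *)
Lemma code_prob_avg_le (bad : {ffun 'I_n2 -> letter2} ->
    'I_Ma -> 'I_Mb -> {ffun 'I_n2 -> Ya * Yb} -> bool) (c : R) :
  (forall wa wb, Ex (iid law_letter2) (fun w2 => Ex (kprod (chan2 wa wb) w2)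
     (fun y => (bad w2 wa wb y)%:R)) <= c) ->
  Ex (iid law_letter1) (fun w1 => Ex (iid law_letter2) (fun w2 =>
    code_prob (code w1 w2) W1 W2 (bad w2))) <= bound_relays + c.
Proof.
move=> hc; have h1 := iid_pmf 'I_n1 p1_pmf; have h2 := iid_pmf 'I_n2 p2_pmf.
pose av (F : 'I_Ma -> 'I_Mb -> R) := ((Ma * Mb)%:R)^-1 * \sum_wa \sum_wb F wa wb.
apply: (@le_trans _ _ (av (fun wa wb => Ex (iid law_letter1) (fun w1 => Ex (iid law_letter2) (fun w2 =>
  Ex (kprod (chan1 wa wb) w1) (relay_err w1 wa wb) +
  Ex (kprod (chan2 wa wb) w2) (fun y => (bad w2 wa wb y)%:R)))))).
  have -> : av (fun wa wb => Ex (iid law_letter1) (fun w1 => Ex (iid law_letter2) (fun w2 =>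
      Ex (kprod (chan1 wa wb) w1) (relay_err w1 wa wb) +
      Ex (kprod (chan2 wa wb) w2) (fun y => (bad w2 wa wb y)%:R)))) =
    Ex (iid law_letter1) (fun w1 => Ex (iid law_letter2) (fun w2 => av (fun wa wb =>
      Ex (kprod (chan1 wa wb) w1) (relay_err w1 wa wb) +
      Ex (kprod (chan2 wa wb) w2) (fun y => (bad w2 wa wb y)%:R)))).
    rewrite /av; under [RHS]eq_Ex do rewrite ExZ Ex_sum.
    rewrite ExZ Ex_sum; congr (_ * _); apply: eq_bigr => wa _.
    under [RHS]eq_Ex do rewrite Ex_sum.
    by rewrite Ex_sum.
  apply: le_Ex => // w1 _; apply: le_Ex => // w2 _.
  rewrite /code_prob /av ler_wpM2l ?invr_ge0 //.
  apply: ler_sum => wa _; apply: ler_sum => wb _.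
  exact: (code_err_le w1 w2 wa wb (bad w2 wa wb)).
(* Averaging a constant needs [Ma] and [Mb] nonzero, as [a0] and [b0] witness. *)
have -> : bound_relays + c = av (fun _ _ => bound_relays + c).
  rewrite /av !sumr_const !card_ord -mulrnA mulnC -[X in _^-1 * X]mulr_natl mulKf //.
  rewrite pnatr_eq0 -lt0n muln_gt0.
  by rewrite (leq_ltn_trans _ (ltn_ord a0)) ?(leq_ltn_trans _ (ltn_ord b0)).
rewrite ler_wpM2l ?invr_ge0 //; apply: ler_sum => wa _; apply: ler_sum => wb _.
under eq_Ex do rewrite ExD Ex_const //.
by rewrite ExD Ex_const // lerD ?hc ?relay_err_le.
Qed.

(** Bounding the mean of the sum of both errors yields a single codebook that serves both
    terminals. *)
Lemma random_coding : exists C : mabc_code X Y Xa Xb Ya Yb A B n1 n2 Ma Mb,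
  err_at_a C W1 W2 + err_at_b C W1 W2 <=
  (bound_relays + bound_a) + (bound_relays + bound_b).
Proof.
have h1 := iid_pmf 'I_n1 p1_pmf; have h2 := iid_pmf 'I_n2 p2_pmf.
suff : Ex (iid law_letter1) (fun w1 => Ex (iid law_letter2) (fun w2 =>
    err_at_a (code w1 w2) W1 W2 + err_at_b (code w1 w2) W1 W2)) <=
    (bound_relays + bound_a) + (bound_relays + bound_b).
  by move=> /(Ex_pick h1)[w1 /(Ex_pick h2)[w2]]; exists (code w1 w2).
rewrite Ex2D; apply: lerD.
- apply: (code_prob_avg_le (bad := fun w2 wa wb y2 =>
    deca w2 wa [ffun k => (y2 k).1] != wb)) => wa wb.
  have funE (y : {ffun 'I_n2 -> Ya * Yb}) :
      [ffun k => (y k).1] = (fun k => (y k).1) :> ('I_n2 -> Ya).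
    by apply/funext => k; rewrite ffunE.
  under eq_Ex do under eq_Ex do rewrite funE.
  exact: terminal_a_le.
- apply: (code_prob_avg_le (bad := fun w2 wa wb y2 =>
    decb w2 wb [ffun k => (y2 k).2] != wa)) => wa wb.
  have funE (y : {ffun 'I_n2 -> Ya * Yb}) :
      [ffun k => (y k).2] = (fun k => (y k).2) :> ('I_n2 -> Yb).
    by apply/funext => k; rewrite ffunE.
  under eq_Ex do under eq_Ex do rewrite funE.
  exact: terminal_b_le.
Qed.

End RandomCoding.

(** * Passage to the limit and achievability *)

Lemma code_prob_ge0 (R : realType) (m : nat) (X Y : 'I_m -> finType)
    (Xa Xb Ya Yb : finType) (A B : {set 'I_m}) (n1 n2 Ma Mb : nat)
    (C : mabc_code X Y Xa Xb Ya Yb A B n1 n2 Ma Mb)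
    (W1 : Xa -> Xb -> outR Y -> R) (W2 : in2 X A B -> Ya * Yb -> R) bad :
  (forall xa xb, is_pmf (W1 xa xb)) -> (forall x2, is_pmf (W2 x2)) ->
  0 <= code_prob C W1 W2 bad.
Proof.
move=> HW1 HW2; rewrite /code_prob mulr_ge0 ?invr_ge0 //.
do 4!(apply: sumr_ge0 => ? _).
rewrite !mulr_ge0 // prodr_ge0 // => k _; first exact: (HW1 _ _).1.
exact: (HW2 _).1.
Qed.

(** Each minimum over relays is unfolded into one strict inequality per relay, so an empty index set
    imposes nothing. *)
Theorem theorem4 (R : realType) (m : nat) (X Y : 'I_m -> finType)
  (Xa Xb Ya Yb : finType) (A B : {set 'I_m})
  (W1 : Xa -> Xb -> outR Y -> R) (W2 : in2 X A B -> Ya * Yb -> R)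
  (HW1 : forall xa xb, is_pmf (W1 xa xb))
  (HW2 : forall x2, is_pmf (W2 x2))
  (D1 D2 : R) (hD1 : 0 <= D1) (hD2 : 0 <= D2) (hD : D1 + D2 = 1)
  (Q : finType) (hQ : (#|Q| <= 3 * m + 2)%N)
  (pQ : Q -> R) (pa : Q -> Xa -> R) (pb : Q -> Xb -> R)
  (pAB : Q -> inS X (A :&: B) -> R) (pAo : Q -> inS X (A :\: B) -> R)
  (pBo : Q -> inS X (B :\: A) -> R)
  (hpQ : is_pmf pQ) (hpa : forall q, is_pmf (pa q))
  (hpb : forall q, is_pmf (pb q)) (hpAB : forall q, is_pmf (pAB q))
  (hpAo : forall q, is_pmf (pAo q)) (hpBo : forall q, is_pmf (pBo q))
  (Ra Rb : R) (hRa : 0 <= Ra) (hRb : 0 <= Rb) :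
  let P := joint_pmf pQ pa pb W1 pAB pAo pBo W2 in
  let Qv := @rvQ m X Y Xa Xb Ya Yb A B Q in
  let Xav := @rvXa m X Y Xa Xb Ya Yb A B Q in
  let Xbv := @rvXb m X Y Xa Xb Ya Yb A B Q in
  let Yrv := @rvYr m X Y Xa Xb Ya Yb A B Q in
  (forall r, r \in A :&: B ->
     Ra < D1 * cmi P Xav (Yrv r) (fun w => (Xbv w, Qv w))) ->
  (forall r, r \in A :\: B -> Ra < D1 * cmi P Xav (Yrv r) Qv) ->
  Ra < D2 * cmi P (@rvXA m X Y Xa Xb Ya Yb A B Q) (@rvYb m X Y Xa Xb Ya Yb A B Q) Qv ->
  (forall r, r \in A :&: B ->
     Rb < D1 * cmi P Xbv (Yrv r) (fun w => (Xav w, Qv w))) ->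
  (forall r, r \in B :\: A -> Rb < D1 * cmi P Xbv (Yrv r) Qv) ->
  Rb < D2 * cmi P (@rvXB m X Y Xa Xb Ya Yb A B Q) (@rvYa m X Y Xa Xb Ya Yb A B Q) Qv ->
  (forall r, r \in A :&: B ->
     Ra + Rb < D1 * cmi P (fun w => (Xav w, Xbv w)) (Yrv r) Qv) ->
  achievable W1 W2 D1 D2 Ra Rb.
Proof.
move=> P Qv Xav Xbv Yrv ha haA hA hb hbB hB hab.
have D1le : D1 <= 1 by rewrite -hD lerDl.
have D2le : D2 <= 1 by rewrite -hD lerDr.
(* Phase 1 gets [D1 * n] rounded down and phase 2 the remainder, so the lengths add up to [n] and
   each is within one of its target. *)
pose n1 n := Num.truncn (D1 * n%:R).
pose n2 n := (n - n1 n)%N.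
have n1_le n : (n1 n)%:R <= D1 * n%:R by rewrite truncn_le // mulr_ge0.
have n1_len n : (n1 n <= n)%N.
  by rewrite -(ler_nat R) (le_trans (n1_le n)) // ler_piMl.
have n2E n : (n2 n)%:R = n%:R - (n1 n)%:R :> R by rewrite natrB.
have n1_ge n : D1 * n%:R <= (n1 n)%:R + 1 by rewrite natr1 ltW // truncnS_gt.
have n2_ge n : D2 * n%:R <= (n2 n)%:R + 1.
  rewrite n2E (_ : D2 = 1 - D1); last by rewrite -hD addrC addKr.
  by rewrite mulrBl mul1r -addrA lerD2l ler_wpDr // lerN2.
have n2_le n : (n2 n)%:R <= D2 * n%:R + 1.
  rewrite n2E (_ : D2 = 1 - D1); last by rewrite -hD addrC addKr.
  by rewrite mulrBl mul1r -addrA lerD2l [leRHS]addrC lerBrDr addrC lerBlDl.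
pose ta r := threshold D1 (cmi P Xav (Yrv r) (fun w => (Xbv w, Qv w))) Ra.
pose tb r := threshold D1 (cmi P Xbv (Yrv r) (fun w => (Xav w, Qv w))) Rb.
pose tab r := threshold D1 (cmi P (fun w => (Xav w, Xbv w)) (Yrv r) Qv) (Ra + Rb).
pose ua r := threshold D1 (cmi P Xav (Yrv r) Qv) Ra.
pose ub r := threshold D1 (cmi P Xbv (Yrv r) Qv) Rb.
pose sa := threshold D2 (cmi P (@rvXA m X Y Xa Xb Ya Yb A B Q)
  (@rvYb m X Y Xa Xb Ya Yb A B Q) Qv) Ra.
pose sb := threshold D2 (cmi P (@rvXB m X Y Xa Xb Ya Yb A B Q)
  (@rvYa m X Y Xa Xb Ya Yb A B Q) Qv) Rb.
have lt_thr (D I r : R) : 0 <= D -> 0 <= r -> r < D * I -> threshold D I r < ln 2 * I.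
  by move=> D0 r0 /(threshold_lt D0 r0)[].
(* The fallback messages of the decoders are 0, which exists because the rates are nonnegative. *)
have H n := random_coding HW1 HW2 hpQ hpa hpb hpAB hpAo hpBo (n1 n) (n2 n)
  (ta := ta) (tb := tb) (tab := tab) (ua := ua) (ub := ub) (sa := sa) (sb := sb)
  (Ordinal (nmsg_gt0 n hRa)) (Ordinal (nmsg_gt0 n hRb))
  (fun r rD => lt_thr _ _ _ hD1 hRa (ha r rD)) (fun r rD => lt_thr _ _ _ hD1 hRb (hb r rD))
  (fun r rD => lt_thr _ _ _ hD1 (addr_ge0 hRa hRb) (hab r rD))
  (fun r rD => lt_thr _ _ _ hD1 hRa (haA r rD)) (fun r rD => lt_thr _ _ _ hD1 hRb (hbB r rD))
  (lt_thr _ _ _ hD2 hRa hA) (lt_thr _ _ _ hD2 hRb hB).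
pose C n := sval (cid (H n)).
have hC n := svalP (cid (H n)).
have hMa n : (0 : R) <= (nmsg Ra n)%:R <= expR (n%:R * (Ra * ln 2)).
  by rewrite ler0n nmsg_le.
have hMb n : (0 : R) <= (nmsg Rb n)%:R <= expR (n%:R * (Rb * ln 2)).
  by rewrite ler0n nmsg_le.
have hMab n : (0 : R) <= (nmsg Ra n)%:R * (nmsg Rb n)%:R <= expR (n%:R * ((Ra + Rb) * ln 2)).
  by rewrite mulr_ge0 //= mulrDl mulrDr expRD ler_pM ?nmsg_le.
(* Both errors are nonnegative, so each vanishes as soon as their sum does. *)
have sum0 : (fun n => err_at_a (C n) W1 W2 + err_at_b (C n) W1 W2) @ \oo --> (0 : R).
  pose bR n := bound_relays W1 W2 pQ pa pb pAB pAo pBo (n1 n) (nmsg Ra n) (nmsg Rb n)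
    ta tb tab ua ub.
  pose ba n := bound_a W1 W2 pQ pa pb pAB pAo pBo (n2 n) (nmsg Rb n) sb.
  pose bb n := bound_b W1 W2 pQ pa pb pAB pAo pBo (n2 n) (nmsg Ra n) sa.
  apply: (@squeeze0 _ _ (fun n => bR n + ba n + (bR n + bb n))) => [n|].
    by apply/andP; split; [rewrite addr_ge0 // code_prob_ge0 | exact: (hC n)].
  (* Relay sets and thresholds do not depend on the block length, so this is a fixed finite sum of
     vanishing terms. *)
  have rel : bR @ \oo --> (0 : R).
    rewrite /bound_relays; apply: cvgD0; first apply: cvgD0; apply: cvg_sum0 => r rD.
    - have [m1 f1] := cvg_test D1le n1_ge hD1 hRa (ha r rD) hMa.
      have [m2 f2] := cvg_test D1le n1_ge hD1 hRb (hb r rD) hMb.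
      have [m3 f3] := cvg_test D1le n1_ge hD1 (addr_ge0 hRa hRb) (hab r rD) hMab.
      apply: (cvgD0 _ f3); apply: (cvgD0 _ f2); apply: (cvgD0 _ f1).
      apply: (cvgD0 _ (m3 _)); exact: cvgD0 (m1 _) (m2 _).
    - by have [m1 f1] := cvg_test D1le n1_ge hD1 hRa (haA r rD) hMa; apply: cvgD0 (m1 _) f1.
    - by have [m1 f1] := cvg_test D1le n1_ge hD1 hRb (hbB r rD) hMb; apply: cvgD0 (m1 _) f1.
  apply: cvgD0; apply: cvgD0 => //.
  - by have [m1 f1] := cvg_test D2le n2_ge hD2 hRb hB hMb; apply: cvgD0 (m1 _) f1.
  - by have [m1 f1] := cvg_test D2le n2_ge hD2 hRa hA hMa; apply: cvgD0 (m1 _) f1.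
exists n1, n2, C; split; [|split; [|split; [|split]]].
- by move=> n; rewrite subnKC.
- apply: cvg_len_ratio => // n; rewrite (le_trans (n1_le n)) // lerDl //.
- exact: cvg_len_ratio.
- apply: squeeze0 sum0 => n.
  by rewrite code_prob_ge0 //= lerDl code_prob_ge0.
- apply: squeeze0 sum0 => n.
  by rewrite code_prob_ge0 //= lerDr code_prob_ge0.
Qed.
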